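(* Let $A$ be the Weyl algebra of polynomial differential operators in two variables $x,y$ over $\mathbb C$, and let $\mathfrak k\simeq\mathfrak{sl}(2)$ be the Lie subalgebra of $A$ spanned by $$E=x\partial_y+y^2,\quad H=3x\partial_x+y\partial_y+2,\quad F=3y\partial_x-\partial_y^2 .$$ Up to isomorphism there exist exactly two simple $(A,\mathfrak k)$-modules, and they have the following $\mathfrak k$-module decompositions: $$V_0\oplus V_3\oplus V_6\oplus V_9\oplus\cdots,\qquad V_1\oplus V_4\oplus V_7\oplus V_{10}\oplus\cdots .$$
   Context: An $(A,\mathfrak k)$-module is an $A$-module on which $\mathfrak k\subset A$ acts locally finitely (hence semisimply). $V_k$ is the simple $(k+1)$-dimensional $\mathfrak{sl}(2)$-module. This $\mathfrak k$ is the image of a principal $\mathfrak{sl}(2)$-subalgebra of $\mathfrak{sp}(4)$ under the standard homomorphism $U(\mathfrak{sp}(4))\to A$ whose image is the even part of $A$. *)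

(* Defs.v *)
From HB Require Import structures.
From mathcomp Require Import all_boot all_order all_algebra.
From mathcomp Require Import mpoly complex.
From mathcomp Require Import boolp functions reals.
From mathcomp Require Import ring.

Set Implicit Arguments.
Unset Strict Implicit.
Unset Printing Implicit Defensive.

Import GRing.Theory Num.Theory.
Local Open Scope ring_scope.

Section WeylAlgebra.
Variable K : fieldType.
Local Notation P := {mpoly K[2]}.

(* Scalars, and hence opposites, are multiplications by constants. *)
Inductive is_diffop : (P -> P) -> Prop :=
| diffop_mul (p : P) : is_diffop (fun q => p * q)
| diffop_der (i : 'I_2) : is_diffop (fun q => q^`M(i))
| diffop_add f g : is_diffop f -> is_diffop g -> is_diffop (fun q => f q + g q)
| diffop_comp f g : is_diffop f -> is_diffop g -> is_diffop (f \o g).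

Definition diffop : {pred P -> P} := fun f => `[< is_diffop f >].

Lemma diffop_submod_closed : submod_closed diffop.
Proof.
split=> [|c f g /asboolP df /asboolP dg]; apply/asboolP.
  rewrite (_ : 0 = fun q : P => 0 * q); first exact: diffop_mul.
  by apply/funext => q; rewrite mul0r.
rewrite (_ : c *: f + g = fun q : P => ((fun r => c%:MP * r) \o f) q + g q).
  by apply: diffop_add => //; apply: diffop_comp => //; apply: diffop_mul.
by apply/funext => q /=; rewrite mul_mpolyC.
Qed.

HB.instance Definition _ :=
  GRing.isSubmodClosed.Build K (P -> P) diffop diffop_submod_closed.

Record weyl : Type := Weyl { weyl_op :> P -> P; weyl_opP : weyl_op \in diffop }.

HB.instance Definition _ := [isSub for weyl_op].
HB.instance Definition _ := [Choice of weyl by <:].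
HB.instance Definition _ := [SubChoice_isSubZmodule of weyl by <:].
HB.instance Definition _ := [SubZmodule_isSubLmodule of weyl by <:].

Lemma weyl_ext (a b : weyl) : (forall p, a p = b p) -> a = b.
Proof. by move=> ab; apply/val_inj/funext. Qed.

Lemma weyl_addE (a b : weyl) p : (a + b) p = a p + b p.
Proof. by []. Qed.

Lemma weyl_oppE (a : weyl) p : (- a) p = - a p.
Proof. by []. Qed.

Lemma weyl_scaleE c (a : weyl) p : (c *: a) p = c *: a p.
Proof. by []. Qed.

Lemma weyl_opD (a : weyl) : {morph a : p q / p + q}.
Proof.
case: a => f /= /asboolP; elim=> {f} /=.
- by move=> p q r; rewrite mulrDr.
- by move=> i q r; rewrite mderivD.
- by move=> f g _ fD _ gD q r; rewrite fD gD addrACA.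
- by move=> f g _ fD _ gD q r /=; rewrite gD fD.
Qed.

Lemma weyl_opZ (a : weyl) c : {morph a : p / c *: p}.
Proof.
case: a => f /= /asboolP; elim=> {f} /=.
- by move=> p q; rewrite scalerAr.
- by move=> i q; rewrite mderivZ.
- by move=> f g _ fZ _ gZ q; rewrite fZ gZ scalerDr.
- by move=> f g _ fZ _ gZ q /=; rewrite gZ fZ.
Qed.

Definition weyl_mul_poly (p : P) : weyl :=
  Weyl (introT (asboolP _) (diffop_mul p)).

Definition weyl_der (i : 'I_2) : weyl :=
  Weyl (introT (asboolP _) (diffop_der i)).

Definition weyl_comp (a b : weyl) : weyl :=
  Weyl (introT (asboolP _)
    (diffop_comp (elimT (asboolP _) (weyl_opP a))
                 (elimT (asboolP _) (weyl_opP b)))).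

Fact weyl_compA : associative weyl_comp.
Proof. by move=> a b c; apply: weyl_ext. Qed.

Fact weyl_comp1l : left_id (weyl_mul_poly 1) weyl_comp.
Proof. by move=> a; apply: weyl_ext => p /=; rewrite mul1r. Qed.

Fact weyl_comp1r : right_id (weyl_mul_poly 1) weyl_comp.
Proof. by move=> a; apply: weyl_ext => p /=; rewrite mul1r. Qed.

Fact weyl_compDl : left_distributive weyl_comp +%R.
Proof. by move=> a b c; apply: weyl_ext. Qed.

Fact weyl_compDr : right_distributive weyl_comp +%R.
Proof. by move=> a b c; apply: weyl_ext => p; exact: weyl_opD. Qed.

Fact weyl_one_neq0 : weyl_mul_poly 1 != 0.
Proof.
apply/eqP => /(congr1 (fun a : weyl => a 1)) /= /eqP.
by rewrite mulr1 oner_eq0.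
Qed.

HB.instance Definition _ := GRing.Zmodule_isNzRing.Build weyl
  weyl_compA weyl_comp1l weyl_comp1r weyl_compDl weyl_compDr weyl_one_neq0.

Lemma weyl_mulE (a b : weyl) p : (a * b) p = a (b p).
Proof. by []. Qed.

Lemma weyl_oneE p : (1 : weyl) p = p.
Proof. exact: mul1r. Qed.

Fact weyl_scaleAl (c : K) (a b : weyl) : c *: (a * b) = (c *: a) * b.
Proof. by apply: weyl_ext. Qed.

HB.instance Definition _ := GRing.Lmodule_isLalgebra.Build K weyl weyl_scaleAl.

Fact weyl_scaleAr (c : K) (a b : weyl) : c *: (a * b) = a * (c *: b).
Proof. by apply: weyl_ext => p; rewrite weyl_mulE !weyl_scaleE weyl_opZ. Qed.

HB.instance Definition _ := GRing.Lalgebra_isAlgebra.Build K weyl weyl_scaleAr.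

Definition weyl_x : weyl := weyl_mul_poly 'X_0.
Definition weyl_y : weyl := weyl_mul_poly 'X_1.
Definition weyl_dx : weyl := weyl_der 0.
Definition weyl_dy : weyl := weyl_der 1.

Definition kE : weyl := weyl_x * weyl_dy + weyl_y ^+ 2.
Definition kH : weyl := 3%:R * weyl_x * weyl_dx + weyl_y * weyl_dy + 2%:R.
Definition kF : weyl := 3%:R * weyl_y * weyl_dx - weyl_dy ^+ 2.

Definition kk : {pred weyl} :=
  fun a => `[< exists e h f : K, a = e *: kE + h *: kH + f *: kF >].

Lemma weyl_natE n p : (n%:R : weyl) p = n%:R * p.
Proof.
elim: n => [|n IH]; first by rewrite mul0r.
by rewrite !mulrSr weyl_addE IH weyl_oneE mulrDl mul1r.
Qed.

Lemma kE_E p : kE p = 'X_0 * p^`M(1) + 'X_1 ^+ 2 * p.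
Proof. by rewrite weyl_addE /= mulrA. Qed.

Lemma kH_E p : kH p = 3%:R * 'X_0 * p^`M(0) + 'X_1 * p^`M(1) + 2%:R * p.
Proof. by rewrite 2!weyl_addE -mulrA !weyl_mulE !weyl_natE /= !mulrA. Qed.

Lemma kF_E p : kF p = 3%:R * 'X_1 * p^`M(0) - p^`M(1)^`M(1).
Proof. by rewrite weyl_addE weyl_oppE -mulrA !weyl_mulE !weyl_natE /= !mulrA. Qed.

Lemma mderiv_U (i j : 'I_2) : ('X_i : P)^`M(j) = (i == j)%:R.
Proof.
rewrite mderivX mnm1E; case: eqP => [->|_]; last by rewrite scale0r.
by rewrite scale1r -{1}[U_(j)%MM]add0m addmK mpolyX0.
Qed.

Lemma mderiv_nat n (j : 'I_2) : (n%:R : P)^`M(j) = 0.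
Proof. by rewrite -mpolyC_nat mderivC. Qed.

Let derE := (expr2, mderivD, mderivB, mderivN, mderivM, mderiv_U, mderiv_nat).
Let d10 (p : P) : p^`M(1)^`M(0) = p^`M(0)^`M(1).
Proof. exact: mderiv_comm. Qed.

(* These brackets, together with k_free, make kk a Lie subalgebra isomorphic
   to sl(2). *)
Lemma k_bracket_HE : kH * kE - kE * kH = 2%:R *: kE.
Proof.
apply: weyl_ext => p; rewrite weyl_addE weyl_oppE weyl_scaleE !weyl_mulE.
rewrite !(kE_E, kH_E) !derE /= -mul_mpolyC mpolyC_nat !d10.
ring.
Qed.

Lemma k_bracket_HF : kH * kF - kF * kH = - (2%:R *: kF).
Proof.
apply: weyl_ext => p; rewrite weyl_addE !weyl_oppE weyl_scaleE !weyl_mulE.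
rewrite !(kF_E, kH_E) !derE /= -mul_mpolyC mpolyC_nat !d10.
ring.
Qed.

Lemma k_bracket_EF : kE * kF - kF * kE = kH.
Proof.
apply: weyl_ext => p; rewrite weyl_addE weyl_oppE !weyl_mulE.
rewrite !(kE_E, kH_E, kF_E) !derE /= !d10.
ring.
Qed.

Lemma k_free (e h f : K) : (2%:R : K) != 0 ->
  e *: kE + h *: kH + f *: kF = 0 -> [/\ e = 0, h = 0 & f = 0].
Proof.
move=> K2 k0.
have k0v p v : e * (kE p).@[v] + h * (kH p).@[v] + f * (kF p).@[v] = 0.
  by rewrite -!mevalZ -!mevalD -!weyl_scaleE -!weyl_addE k0 meval0.
have d1 i : (1 : P)^`M(i) = 0 by rewrite -[1]mpolyC1 mderivC.
have {}k0v := (k0v 1 (fun=> 0), k0v 1 (fun=> 1), k0v ('X_1 ^+ 2) (fun=> 0)).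
move: k0v; rewrite !(kE_E, kH_E, kF_E) !derE !d1 /= mderiv0.
rewrite !(mulr0, mulr1, add0r, addr0, subr0, mulr0n).
rewrite !(mevalD, mevalB, mevalN, mevalM, mevalXU, meval1, meval0).
rewrite !(mulr0, mul0r, mulr1, mul1r, add0r, addr0).
case=> [[/eqP + k1] /eqP].
rewrite !mulf_eq0 oppr_eq0 !(negbTE K2) !orbF => /eqP h0 /eqP f0.
by move: k1; rewrite h0 mul0r addr0.
Qed.

End WeylAlgebra.

Arguments kk K : clear implicits.

Section Modules.
Variables (K : fieldType) (A : algType K).

Definition simple_module (M : lmodType A) : Prop :=
  (exists m : M, m != 0) /\
  forall N : {pred M}, submod_closed N ->
    (forall m, m \in N -> m = 0) \/ (forall m, m \in N).

Definition isomorphic (M N : lmodType A) : Prop :=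
  exists f : {linear M -> N}, bijective f.

(* An A-module seen as a K-vector space through K -> A, c |-> c%:A. *)
Definition restrict (M : lmodType A) : Type := M.

Section Restrict.
Variable M : lmodType A.

HB.instance Definition _ := GRing.Zmodule.on (restrict M).

Definition restrict_scale (c : K) (m : restrict M) : restrict M :=
  (c%:A : A) *: (m : M).

Fact restrict_scaleA c d m :
  restrict_scale c (restrict_scale d m) = restrict_scale (c * d) m.
Proof. by rewrite /restrict_scale scalerA -scalerAl mul1r scalerA. Qed.

Fact restrict_scale1 : left_id 1 restrict_scale.
Proof. by move=> m; rewrite /restrict_scale !scale1r. Qed.

Fact restrict_scaleDr : right_distributive restrict_scale +%R.
Proof. by move=> c m n; rewrite /restrict_scale scalerDr. Qed.

Fact restrict_scaleDl m :
  {morph (fun c => restrict_scale c m) : c d / c + d}.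
Proof. by move=> c d; rewrite /restrict_scale !scalerDl. Qed.

HB.instance Definition _ := GRing.Zmodule_isLmodule.Build K (restrict M)
  restrict_scaleA restrict_scale1 restrict_scaleDr restrict_scaleDl.

End Restrict.

Definition has_dim (V : lmodType K) (W : {pred V}) (d : nat) : Prop :=
  exists b : 'I_d -> V,
    (forall c : 'I_d -> K, \sum_i c i *: b i = 0 -> forall i, c i = 0) /\
    (forall v, v \in W <-> exists c : 'I_d -> K, v = \sum_i c i *: b i).

Definition direct_sum (V : lmodType K) (W : nat -> {pred V}) : Prop :=
  (forall v, exists (n : nat) (w : nat -> V),
     (forall i, w i \in W i) /\ v = \sum_(i < n) w i) /\
  (forall (n : nat) (w : nat -> V),
     (forall i, w i \in W i) -> \sum_(i < n) w i = 0 ->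
     forall i, (i < n)%N -> w i = 0).

(* Below, g is (the underlying set of) a Lie subalgebra of A, acting on an
   A-module through A. *)
Section LieAction.
Variable g : {pred A}.

Definition lie_submodule (M : lmodType A) (W : {pred restrict M}) : Prop :=
  submod_closed W /\
  forall (a : A) (w : M), a \in g -> w \in W -> a *: w \in W.

Definition simple_lie_submodule (M : lmodType A) (W : {pred restrict M}) :=
  [/\ lie_submodule W,
      exists2 w, w \in W & w != 0 &
      forall W' : {pred restrict M}, lie_submodule W' -> {subset W' <= W} ->
        (forall w, w \in W' -> w = 0) \/ {subset W <= W'}].

Definition locally_finite (M : lmodType A) : Prop :=
  forall m : M, exists (W : {pred restrict M}) (d : nat),
    [/\ lie_submodule W, has_dim W d & m \in W].

(* For g isomorphic to sl(2) this says that W is a copy of V_n, the simple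
   sl(2)-module of dimension n + 1. *)
Definition is_V (n : nat) (M : lmodType A) (W : {pred restrict M}) : Prop :=
  simple_lie_submodule W /\ has_dim W n.+1.

Definition decomposes_as (n : nat -> nat) (M : lmodType A) : Prop :=
  exists W : nat -> {pred restrict M},
    (forall i, is_V (n i) (W i)) /\ direct_sum W.

End LieAction.

Definition simple_module_for (g : {pred A}) (M : lmodType A) : Prop :=
  simple_module M /\ locally_finite g M.

End Modules.

(* Main.v *)
(** A vector v with E v = 0 and H v = n v behaves like the function
    x^((n-2)/3) exp(-y^3/(3x)): these two equations determine its derivatives
    after multiplication by a power of x.  On a locally finite module x acts
    injectively, so the annihilator of v depends only on n, and a simple
    module with such a v is the module generated by that function.  An explicit
    element of the Weyl algebra maps v to a vector of weight n - 3 that is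
    nonzero unless n is 0 or 1.  Since highest weights of locally finite modules
    are natural numbers, n = 2 is impossible, so every module contains such a v
    with n = 0 or n = 1.  For these n, F^(m+1) kills x^a v, where m = 3a + n,
    since otherwise it would be a highest weight vector of weight -m - 2, which
    has the wrong class modulo 3; the modules V_m generated by the x^a v then
    exhaust the module. *)

Require Import Defs.
From mathcomp Require Import all_boot all_order all_algebra.
From mathcomp Require Import mpoly complex reals.
From HB Require Import structures.
From mathcomp Require Import boolp functions.
From mathcomp Require Import ring zify.

Set Implicit Arguments.
Unset Strict Implicit.
Unset Printing Implicit Defensive.

Import Order.TTheory GRing.Theory Num.Theory.
Local Open Scope ring_scope.

(** * The Weyl algebra by generators and relations *)

(** [weyl] consists of operators on polynomials, so it can act on other functions only once all its
    relations are known to follow from the commutation relations of x, y, d/dx, d/dy. This is why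
    normal ordering is shown to be bijective before any module is built.

    The function of the overview comes from solving the two equations: E f = 0 reads x f_y = - y^2
    f, so f = g(x) exp(-y^3/(3x)), and H f = n f then reduces to 3 x g' = (n - 2) g. Formal sums of
    monomials, with the common factor left implicit, stand in for such functions, so that no branch
    of x^((n-2)/3) has to be chosen. They are built for every scalar n, because the function of
    weight n is the model for all highest weight vectors v of weight n: an identity a v = 0 in an
    abstract module is obtained by a computation with monomials, and the annihilator itself is never
    determined. *)

Lemma deriv_stable_const (K : numFieldType) n (Q : {mpoly K[n]} -> Prop) p :
  (forall i q, Q q -> Q q^`M(i)) -> Q p -> p != 0 -> exists2 c, c != 0 & Q c%:MP.
Proof.
move=> QD Qp p0; set m := mlead p.
have QDm k : Q p^`M[k].
  rewrite mderivm_foldr; elim: (flatten _) => //= i s IH; exact: QD.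
(* The coefficient of k in this derivative is a multiple of the coefficient of m + k in p, which
   vanishes for k != 0 because m is leading. *)
exists (p^`M[m])@_0.
  rewrite mcoeff_mderivm addm0 -mulr_natr mulf_neq0 ?mleadc_eq0 //.
  by rewrite pnatr_eq0 -lt0n prodn_gt0 // => i; rewrite ffactnn fact_gt0.
rewrite (_ : _%:MP = p^`M[m]) //; apply/mpolyP => k; rewrite mcoeffC.
have [<-|k0] := eqVneq 0%MM k; first by rewrite mulr1.
rewrite mulr0 mcoeff_mderivm mcoeff_gt_mlead ?mul0rn //.
by rewrite -[X in (X < _)%O]addm0 ltmc_add2r lt_neqAle k0 le0m.
Qed.

Lemma linear_mpoly_ext (K : nzRingType) n (V : lmodType K) (f g : {mpoly K[n]} -> V) :
  linear f -> linear g -> (forall m, f 'X_[m] = g 'X_[m]) -> f =1 g.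
Proof.
move=> fL gL fg; elim/mpolyind => [|c m p _ _ IH]; last by rewrite fL gL fg IH.
by rewrite -[0](addNr (0 : {mpoly K[n]})) -scaleN1r fL gL !scaleN1r !addNr.
Qed.

Lemma comm_add1_exp (S : pzRingType) (a b : S) k :
  a * b = b * a + 1 -> a * b ^+ k = b ^+ k * a + k%:R * b ^+ k.-1.
Proof.
move=> ab; elim: k => [|k IH]; first by rewrite !expr0 mul0r mulr1 mul1r addr0.
rewrite exprSr mulrA IH mulrDl -!mulrA ab mulrDr mulr1 mulrA -addrA; congr (_ + _).
case: k {IH} => [|k]; first by rewrite mul0r addr0 expr0 mulr1.
by rewrite -exprSr /= [in RHS]mulrSr mulrDl mul1r addrC.
Qed.

Lemma comm_add1_expl (S : pzRingType) (a b : S) k :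
  a * b = b * a + 1 -> a ^+ k * b = b * a ^+ k + k%:R * a ^+ k.-1.
Proof.
move=> ab; elim: k => [|k IH]; first by rewrite !expr0 mul0r mulr1 mul1r addr0.
rewrite exprS -mulrA IH mulrDr !mulrA ab mulrDl mul1r -!mulrA -addrA; congr (_ + _).
case: k {IH} => [|k]; first by rewrite mul0r mulr0 addr0 expr0 mulr1.
by rewrite mulrA (commr_nat a) -mulrA -exprS /= [in RHS]mulrSr mulrDl mul1r addrC.
Qed.

Section WeylInd.
Variable K : fieldType.
Local Notation A := (weyl K).

Lemma weyl_ind (Q : A -> Prop) :
  Q 1 -> (forall c a b, Q a -> Q b -> Q (c *: a + b)) ->
  (forall a, Q a -> Q (weyl_x K * a)) -> (forall a, Q a -> Q (weyl_y K * a)) ->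
  (forall a, Q a -> Q (weyl_dx K * a)) -> (forall a, Q a -> Q (weyl_dy K * a)) ->
  forall a, Q a.
Proof.
move=> Q1 QL Qx Qy Qdx Qdy.
have Q0 : Q 0 by rewrite -(addNr 1) -scaleN1r; exact: QL.
have QZ c a : Q a -> Q (c *: a) by move=> Qa; rewrite -[_ *: _]addr0; exact: QL.
have QD a b : Q a -> Q b -> Q (a + b) by rewrite -{2}[a]scale1r; exact: QL.
have QX m a : Q a -> Q (weyl_mul_poly 'X_[m] * a).
  move=> Qa; have -> : weyl_mul_poly 'X_[m] * a =
      iter (m 0) ( *%R (weyl_x K)) (iter (m 1) ( *%R (weyl_y K)) a).
    have itE (b c : A) k : iter k ( *%R b) c = b ^+ k * c.
      by elim: k => [|k IH]; [rewrite mul1r | rewrite iterS IH exprS mulrA].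
    have poE p k : (weyl_mul_poly p : A) ^+ k = weyl_mul_poly (p ^+ k).
      elim: k => [|k IH]; first by [].
      by rewrite exprS IH; apply: weyl_ext => q; rewrite weyl_mulE /= exprS mulrA.
    rewrite !itE mulrA !poE; congr (_ * _); apply: weyl_ext => q.
    rewrite weyl_mulE /= (mpolyXE_id K m) 2!big_ord_recl big_ord0 mulr1 -mulrA.
    by congr (_ * ('X_ _ ^+ m _ * _)); exact/val_inj.
  elim: (m 0) => [|k IH]; last by rewrite iterS; exact: Qx.
  by elim: (m 1) => [|k IH] //; rewrite iterS; exact: Qy.
(* Induction on [f] alone would break at a composition; letting [f] act on top of an arbitrary [a]
   with [Q a] repairs this. *)
suff H f (df : is_diffop f) : forall a b : A, Q a -> (forall p, b p = f (a p)) -> Q b.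
  by move=> a; apply: (H a (elimT (asboolP _) (weyl_opP a)) 1) => // p; rewrite weyl_oneE.
elim: df => {f}.
- move=> p a b Qa; elim/mpolyind: p b => [|c m p _ _ IH] b bE.
    by rewrite (_ : b = 0) //; apply: weyl_ext => p; rewrite bE mul0r.
  have -> : b = c *: (weyl_mul_poly 'X_[m] * a) + weyl_mul_poly p * a.
    apply: weyl_ext => q.
    by rewrite bE weyl_addE weyl_scaleE mulrDl scalerAl.
  by apply: QL; [exact: QX | exact: IH].
- move=> i a b Qa bE; have -> : b = weyl_der K i * a by exact: weyl_ext.
  by case: i {bE} => -[|[|//]] i2; [have -> : Ordinal i2 = 0 by exact/val_inj
    | have -> : Ordinal i2 = 1 by exact/val_inj]; [exact: Qdx | exact: Qdy].
- move=> f g df IHf dg IHg a b Qa bE.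
  pose f' := Weyl (introT (asboolP _) df); pose g' := Weyl (introT (asboolP _) dg).
  have -> : b = f' * a + g' * a by exact: weyl_ext.
  by apply: QD; [exact: (IHf a) | exact: (IHg a)].
- move=> f g df IHf dg IHg a b Qa bE.
  pose g' := Weyl (introT (asboolP _) dg).
  by apply: (IHf (g' * a)) => //; exact: (IHg a).
Qed.

End WeylInd.

(** * Normal ordering *)

Section Quantization.
Variables (K : fieldType) (S : algType K) (x y u v : S).

Definition weyl_relations : Prop :=
  [/\ x * y = y * x, u * v = v * u,
      u * x = x * u + 1 /\ v * y = y * v + 1,
      u * y = y * u & v * x = x * v].

Definition quant_gen (i : 'I_4) : S := nth 0 [:: x; y; u; v] i.

(* The normally ordered operator with polynomial symbol [s]; the symbols of
   x, y, d/dx, d/dy are the four variables. *)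
Definition quant (s : {mpoly K[4]}) : S := mmap (in_alg S) quant_gen s.

Lemma quantX m :
  quant 'X_[m] = x ^+ m 0 * (y ^+ m 1 * (u ^+ m 2%:R * v ^+ m 3%:R)).
Proof.
rewrite /quant mmapX /mmap1 4!big_ord_recl big_ord0 mulr1.
have E (i j : 'I_4) : val i = val j -> quant_gen i ^+ m i = nth 0 [:: x; y; u; v] j ^+ m j.
  by move=> /val_inj ->.
by rewrite (E ord0 0) // (E (lift ord0 ord0) 1) // (E (lift ord0 (lift _ _)) 2%:R) //
  (E (lift _ _) 3%:R).
Qed.


Lemma quant_linear : linear quant.
Proof. by move=> c p q; rewrite /quant mmapD mmapZ -scalerAl mul1r. Qed.

Lemma quant_var i : quant 'X_i = quant_gen i.
Proof. by rewrite /quant mmapX mmap1U. Qed.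

Lemma quantD p q : quant (p + q) = quant p + quant q.
Proof. exact: mmapD. Qed.

Lemma quant1 : quant 1 = 1.
Proof. by rewrite -mpolyX0 quantX !mnm0E !expr0 !mulr1. Qed.

Hypothesis xyuv : weyl_relations.

Let mulX0l (i : 'I_4) : linear (fun p : {mpoly K[4]} => quant ('X_i * p)).
Proof. by move=> c p q /=; rewrite mulrDr -scalerAr quant_linear. Qed.

Let mulSl (a : S) : linear (fun p : {mpoly K[4]} => a * quant p).
Proof. by move=> c p q; rewrite quant_linear mulrDr -scalerAr. Qed.

Let commX0l (a : S) : linear (fun p : {mpoly K[4]} => quant p * a).
Proof. by move=> c p q; rewrite quant_linear mulrDl -scalerAl. Qed.

Let addl (f g : {mpoly K[4]} -> S) : linear f -> linear g ->
  linear (fun p => f p + g p).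
Proof. by move=> fL gL c p q; rewrite fL gL scalerDr addrACA. Qed.

Let derl (i : 'I_4) : linear (fun p : {mpoly K[4]} => quant p^`M(i)).
Proof. by move=> c p q; rewrite mderivD mderivZ quant_linear. Qed.

Let quantZn n p : quant (n%:R *: p) = n%:R * quant p.
Proof.
rewrite -[n%:R *: p]addr0 quant_linear -mpolyC0 [quant _%:MP]mmapC raddf0 addr0.
by rewrite scaler_nat mulr_natl.
Qed.


(** Multiplication by a generator becomes an operation on symbols that is the same in every algebra
    satisfying the relations; this and the following lemmas record these operations. *)
Lemma quant_x p : x * quant p = quant ('X_0 * p).
Proof.
move: p; apply: (linear_mpoly_ext (mulSl x) (mulX0l _)) => m.
by rewrite -mpolyXD !quantX !mnmDE !mnm1E /= !add0n add1n exprS mulrA.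
Qed.

Lemma quant_y p : y * quant p = quant ('X_1 * p).
Proof.
have [xy _ _ _ _] := xyuv.
move: p; apply: (linear_mpoly_ext (mulSl y) (mulX0l _)) => m.
rewrite -mpolyXD !quantX !mnmDE !mnm1E /= !add0n add1n exprS !mulrA.
by rewrite (commrX (m 0) (esym xy : GRing.comm y x)).
Qed.

Lemma quant_u p : u * quant p = quant ('X_2%:R * p) + quant p^`M(0).
Proof.
have [_ uv [ux _] uy _] := xyuv.
move: p; apply: (linear_mpoly_ext (mulSl u) (addl (mulX0l _) (derl _))) => m.
rewrite mderivX quantZn -mpolyXD !quantX !mnmBE !mnmDE !mnm1E /= !add0n !subn0.
rewrite add1n subn1 mulrA comm_add1_exp // mulrDl !mulrA; congr (_ + _).
by rewrite -!mulrA (mulrA u) (commrX (m 1) (uy : GRing.comm u y)) exprS !mulrA.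
Qed.

Lemma quant_v p : v * quant p = quant ('X_3%:R * p) + quant p^`M(1).
Proof.
have [xy uv [ux vy] uy vx] := xyuv.
move: p; apply: (linear_mpoly_ext (mulSl v) (addl (mulX0l _) (derl _))) => m.
rewrite mderivX quantZn -mpolyXD !quantX !mnmBE !mnmDE !mnm1E /= !add0n !subn0.
rewrite add1n subn1 mulrA (commrX (m 0) (vx : GRing.comm v x)) -!mulrA.
rewrite (mulrA v) comm_add1_exp // mulrDl mulrDr; congr (_ + _).
  by rewrite -!mulrA (mulrA v) (commrX (m 2%:R) (esym uv : GRing.comm v u)) exprS !mulrA.
by rewrite !mulrA; congr (_ * _ * _ * _); exact: commr_nat.
Qed.


Lemma quant_ur p : quant p * u = quant ('X_2%:R * p).
Proof.
have [_ uv _ _ _] := xyuv.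
move: p; apply: (linear_mpoly_ext (commX0l u) (mulX0l _)) => m.
rewrite -mpolyXD !quantX !mnmDE !mnm1E /= !add0n add1n exprSr -!mulrA.
by rewrite (commrX (m 3%:R) (uv : GRing.comm u v)).
Qed.

Lemma quant_vr p : quant p * v = quant ('X_3%:R * p).
Proof.
move: p; apply: (linear_mpoly_ext (commX0l v) (mulX0l _)) => m.
by rewrite -mpolyXD !quantX !mnmDE !mnm1E /= !add0n add1n exprSr -!mulrA.
Qed.

Lemma quant_comm_x p : quant p * x = x * quant p + quant p^`M(2%:R).
Proof.
have [xy uv [ux vy] uy vx] := xyuv.
move: p; apply: (linear_mpoly_ext (commX0l x) (addl (mulSl _) (derl _))) => m.
rewrite mderivX quantZn !quantX !mnmBE !mnm1E /= !subn0 subn1.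
rewrite -!mulrA -(commrX (m 3%:R) (esym vx : GRing.comm x v)).
rewrite (mulrA (u ^+ _) x) (comm_add1_expl _ ux) mulrDl !mulrDr; congr (_ + _).
  rewrite -!mulrA (mulrA (y ^+ _) x) -(commrX (m 1) (xy : GRing.comm x y)).
  by rewrite -!mulrA (mulrA (x ^+ _) x) (mulrA x (x ^+ _)) -exprS -exprSr.
rewrite -!mulrA (mulrA (y ^+ _)) (commr_nat _ (m 2%:R)) -mulrA.
by rewrite (mulrA (x ^+ _)) (commr_nat _ (m 2%:R)) -mulrA.
Qed.

Lemma quant_comm_y p : quant p * y = y * quant p + quant p^`M(3%:R).
Proof.
have [xy uv [ux vy] uy vx] := xyuv.
move: p; apply: (linear_mpoly_ext (commX0l y) (addl (mulSl _) (derl _))) => m.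
rewrite mderivX quantZn !quantX !mnmBE !mnm1E /= !subn0 subn1.
rewrite -!mulrA (comm_add1_expl _ vy) !mulrDr; congr (_ + _).
  rewrite (mulrA (u ^+ _) y) -(commrX (m 2%:R) (esym uy : GRing.comm y u)).
  rewrite -mulrA (mulrA (y ^+ _) y) -exprSr (mulrA y (x ^+ _)).
  by rewrite (commrX (m 0) (esym xy : GRing.comm y x)) -mulrA (mulrA y) -exprS.
rewrite (mulrA (u ^+ _)) (commr_nat _ (m 3%:R)) -mulrA.
rewrite (mulrA (y ^+ _)) (commr_nat _ (m 3%:R)) -mulrA.
by rewrite (mulrA (x ^+ _)) (commr_nat _ (m 3%:R)) -mulrA.
Qed.

End Quantization.

(** * Universal property of the Weyl algebra *)

Section WeylUniversal.
Variable K : numFieldType.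
Local Notation A := (weyl K).
Local Notation q := (quant (weyl_x K) (weyl_y K) (weyl_dx K) (weyl_dy K)).

Lemma weyl_gen_relations :
  weyl_relations (weyl_x K) (weyl_y K) (weyl_dx K) (weyl_dy K).
Proof.
split; try split; apply: weyl_ext => p.
- by rewrite !weyl_mulE /= mulrCA.
- by rewrite !weyl_mulE /= mderiv_comm.
- by rewrite weyl_addE weyl_oneE !weyl_mulE /= mderivM mderiv_U mul1r addrC.
- by rewrite weyl_addE weyl_oneE !weyl_mulE /= mderivM mderiv_U mul1r addrC.
- by rewrite !weyl_mulE /= mderivM mderiv_U mul0r add0r.
- by rewrite !weyl_mulE /= mderivM mderiv_U mul0r add0r.
Qed.

Lemma quant_surj (a : A) : exists s, a = q s.
Proof.
have rel := weyl_gen_relations.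
elim/weyl_ind: a => [|c _ _ [s ->] [t ->]|_ [s ->]|_ [s ->]|_ [s ->]|_ [s ->]].
- by exists 1; rewrite quant1.
- by exists (c *: s + t); rewrite quant_linear.
- by exists ('X_0 * s); rewrite quant_x.
- by exists ('X_1 * s); rewrite quant_y.
- by exists ('X_2%:R * s + s^`M(0)); rewrite quant_u // quantD.
- by exists ('X_3%:R * s + s^`M(1)); rewrite quant_v // quantD.
Qed.

(* Commutators with the generators differentiate the symbol, so the symbols of
   the zero operator are stable under differentiation. *)
Lemma quant_eq0 s : q s = 0 -> s = 0.
Proof.
have rel := weyl_gen_relations; have [_ _ [ux vy] uy vx] := rel.
move=> qs0; apply/eqP/negPn/negP => s0.
have [|c c0] := @deriv_stable_const _ _ (fun s => q s = 0) s _ qs0 s0; last first.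
  by rewrite /quant mmapC => /eqP; rewrite scaler_eq0 oner_eq0 (negbTE c0).
case=> -[|[|[|[|//]]]] i4 t qt0.
- have -> : Ordinal i4 = 0 by exact/val_inj.
  by have := quant_u rel t; rewrite -quant_ur // qt0 mulr0 mul0r add0r => <-.
- have -> : Ordinal i4 = 1 by exact/val_inj.
  by have := quant_v rel t; rewrite -quant_vr // qt0 mulr0 mul0r add0r => <-.
- have -> : Ordinal i4 = 2%:R by exact/val_inj.
  by have := quant_comm_x rel t; rewrite qt0 mulr0 mul0r add0r => <-.
- have -> : Ordinal i4 = 3%:R by exact/val_inj.
  by have := quant_comm_y rel t; rewrite qt0 mulr0 mul0r add0r => <-.
Qed.

Lemma quant_inj : injective q.
Proof.
move=> s t st; apply/eqP; rewrite -subr_eq0; apply/eqP/quant_eq0.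
by rewrite -scaleN1r addrC quant_linear st scaleN1r addNr.
Qed.

Definition weyl_symbol (a : A) : {mpoly K[4]} := projT1 (cid (quant_surj a)).

Lemma weyl_symbolK a : q (weyl_symbol a) = a.
Proof. by rewrite /weyl_symbol; case: cid. Qed.

Lemma quantK s : weyl_symbol (q s) = s.
Proof. by apply: quant_inj; rewrite weyl_symbolK. Qed.

Variables (S : algType K) (x y u v : S).
Hypothesis xyuv : weyl_relations x y u v.

Definition weyl_lift (a : A) : S := quant x y u v (weyl_symbol a).

Lemma weyl_lift_quant s : weyl_lift (q s) = quant x y u v s.
Proof. by rewrite /weyl_lift quantK. Qed.

Lemma weyl_lift_linear : linear weyl_lift.
Proof.
move=> c a b; rewrite -[a]weyl_symbolK -[b]weyl_symbolK.
by rewrite -quant_linear !weyl_lift_quant quant_linear.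
Qed.

Lemma weyl_lift1 : weyl_lift 1 = 1.
Proof.
have <- : q 1 = 1 by exact: quant1.
by rewrite weyl_lift_quant quant1.
Qed.

Lemma weyl_lift_x : weyl_lift (weyl_x K) = x.
Proof.
have <- : q 'X_0 = weyl_x K by exact: quant_var.
by rewrite weyl_lift_quant; exact: quant_var.
Qed.

Lemma weyl_lift_y : weyl_lift (weyl_y K) = y.
Proof.
have <- : q 'X_1 = weyl_y K by exact: quant_var.
by rewrite weyl_lift_quant; exact: quant_var.
Qed.

Lemma weyl_lift_dx : weyl_lift (weyl_dx K) = u.
Proof.
have <- : q 'X_2%:R = weyl_dx K by exact: quant_var.
by rewrite weyl_lift_quant; exact: quant_var.
Qed.

Lemma weyl_lift_dy : weyl_lift (weyl_dy K) = v.
Proof.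
have <- : q 'X_3%:R = weyl_dy K by exact: quant_var.
by rewrite weyl_lift_quant; exact: quant_var.
Qed.

(** By [weyl_ind] it suffices to multiply on the left by generators, and there the symbol changes by
    the same formula in [weyl] and in [S]. *)
Lemma weyl_liftM a b : weyl_lift (a * b) = weyl_lift a * weyl_lift b.
Proof.
have rel := weyl_gen_relations.
elim/weyl_ind: a => [|c a a' IH IH'|a IH|a IH|a IH|a IH].
- by rewrite weyl_lift1 !mul1r.
- by rewrite mulrDl -scalerAl !weyl_lift_linear IH IH' mulrDl scalerAl.
- rewrite -mulrA -(weyl_symbolK (a * b)) -{2}(weyl_symbolK a) !quant_x //.
  by rewrite !weyl_lift_quant -!quant_x // -mulrA -IH.
- rewrite -mulrA -(weyl_symbolK (a * b)) -{2}(weyl_symbolK a) !quant_y //.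
  by rewrite !weyl_lift_quant -!quant_y // -mulrA -IH.
- rewrite -mulrA -(weyl_symbolK (a * b)) -{2}(weyl_symbolK a) !quant_u // -!quantD.
  by rewrite !weyl_lift_quant !quantD -!quant_u // -mulrA -IH.
- rewrite -mulrA -(weyl_symbolK (a * b)) -{2}(weyl_symbolK a) !quant_v // -!quantD.
  by rewrite !weyl_lift_quant !quantD -!quant_v // -mulrA -IH.
Qed.

End WeylUniversal.

(** * Functions x^a y^b x^s exp(-y^3/(3x)) *)

Section LaurentEnd.
Variable K : fieldType.

(* Two-sided formal sums of monomials x^a y^b, as coefficient functions. *)
Definition laurent : Type := int -> int -> K^o.
HB.instance Definition _ := Choice.on laurent.
HB.instance Definition _ := GRing.Lmodule.on laurent.

Definition linear_fun : {pred laurent -> laurent} := fun f => `[< linear f >].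

Lemma linear_fun_submod_closed : submod_closed linear_fun.
Proof.
split=> [|c f g /asboolP fL /asboolP gL]; apply/asboolP.
  by move=> c u v; rewrite scaler0 addr0.
move=> d u v; apply/funext => a; apply/funext => b.
have E x y : (x *: y : K^o) = x * y by [].
rewrite -![(c *: f + g) _ _ _]/(c *: f _ _ _ + g _ _ _) fL gL.
rewrite -![(_ *: _ + _) a b]/(_ * _ a b + _ a b) E.
rewrite -![(c *: f + g) _ _ _]/(c *: f _ _ _ + g _ _ _) !E.
ring.
Qed.

HB.instance Definition _ := GRing.isSubmodClosed.Build K (laurent -> laurent)
  linear_fun linear_fun_submod_closed.

Record laurent_end : Type :=
  LaurentEnd { end_fun :> laurent -> laurent; end_funP : end_fun \in linear_fun }.

HB.instance Definition _ := [isSub for end_fun].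
HB.instance Definition _ := [Choice of laurent_end by <:].
HB.instance Definition _ := [SubChoice_isSubZmodule of laurent_end by <:].
HB.instance Definition _ := [SubZmodule_isSubLmodule of laurent_end by <:].

Lemma end_ext (f g : laurent_end) : (forall u, f u = g u) -> f = g.
Proof. by move=> fg; apply/val_inj/funext. Qed.

Lemma end_linear (f : laurent_end) : linear f.
Proof. exact: (elimT (asboolP _) (end_funP f)). Qed.

Fact end_one_linear : (fun u : laurent => u) \in linear_fun.
Proof. by apply/asboolP. Qed.

Fact end_comp_linear (f g : laurent_end) : (fun u => f (g u)) \in linear_fun.
Proof. by apply/asboolP => c u v; rewrite !end_linear. Qed.

Definition end_one : laurent_end := LaurentEnd end_one_linear.
Definition end_comp (f g : laurent_end) : laurent_end :=
  LaurentEnd (end_comp_linear f g).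

Fact end_compA : associative end_comp.
Proof. by move=> f g h; apply: end_ext. Qed.

Fact end_comp1l : left_id end_one end_comp.
Proof. by move=> f; apply: end_ext. Qed.

Fact end_comp1r : right_id end_one end_comp.
Proof. by move=> f; apply: end_ext. Qed.

Fact end_compDl : left_distributive end_comp +%R.
Proof. by move=> f g h; apply: end_ext. Qed.

Fact end_compDr : right_distributive end_comp +%R.
Proof.
move=> f g h; apply: end_ext => u.
have := end_linear f 1 (g u) (h u); rewrite !scale1r; exact.
Qed.

Fact end_one_neq0 : end_one != 0.
Proof.
apply/eqP => /(congr1 (fun f : laurent_end => f (fun=> fun=> 1) 0 0)) /eqP.
by rewrite /= oner_eq0.
Qed.

HB.instance Definition _ := GRing.Zmodule_isNzRing.Build laurent_end
  end_compA end_comp1l end_comp1r end_compDl end_compDr end_one_neq0.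

Fact end_scaleAl (c : K) (f g : laurent_end) : c *: (f * g) = (c *: f) * g.
Proof. by apply: end_ext. Qed.

HB.instance Definition _ :=
  GRing.Lmodule_isLalgebra.Build K laurent_end end_scaleAl.

Fact end_scaleAr (c : K) (f g : laurent_end) : c *: (f * g) = f * (c *: g).
Proof.
apply: end_ext => u; rewrite -[(c *: (f * g)) u]/(c *: f (g u)).
rewrite -[(f * _) u]/(f (c *: g u)) -[in RHS](addr0 (c *: g u)) end_linear.
have -> : f 0 = 0 by have := end_linear f (-1) 0 0; rewrite !scaleN1r !addNr.
by rewrite addr0.
Qed.

HB.instance Definition _ := GRing.Lalgebra_isAlgebra.Build K laurent_end end_scaleAr.

End LaurentEnd.

Section Airy.
Variables (K : numFieldType) (w : K).
Local Notation A := (weyl K).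
Local Notation V := (laurent K).

(* The Weyl algebra acts on the sums of x^a y^b x^s exp(-y^3/(3x)) with
   s = (w - 2)/3, which makes the monomial with a = b = 0 a solution of
   E f = 0 and H f = w f. *)
Definition airy_x (f : V) : V := fun a b => f (a - 1) b.
Definition airy_y (f : V) : V := fun a b => f a (b - 1).
(** The logarithmic derivatives y^3/(3x^2) and -y^2/x of the exponential give the second terms here
    and in [airy_dy]. The indices are shifted upwards because each formula reads off the coefficient
    of x^a y^b in the derivative. *)
Definition airy_dx (f : V) : V := fun a b =>
  ((a + 1)%:~R + (w - 2%:R) / 3%:R) * f (a + 1) b + f (a + 2) (b - 3) / 3%:R.
Definition airy_dy (f : V) : V := fun a b =>
  (b + 1)%:~R * f a (b + 1) - f (a + 1) (b - 2).

Lemma laurent_ext (f g : V) : (forall a b, f a b = g a b) -> f = g.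
Proof. by move=> fg; apply/funext => a; apply/funext => b. Qed.

Let LE (c : K) (f g : V) a b : (c *: f + g) a b = c * f a b + g a b.
Proof. by []. Qed.

Fact airy_x_linear : airy_x \in @linear_fun K. Proof. by apply/asboolP. Qed.
Fact airy_y_linear : airy_y \in @linear_fun K. Proof. by apply/asboolP. Qed.
Fact airy_dx_linear : airy_dx \in @linear_fun K.
Proof.
by apply/asboolP => c f g; apply: laurent_ext => a b; rewrite LE /airy_dx !LE; ring.
Qed.
Fact airy_dy_linear : airy_dy \in @linear_fun K.
Proof.
by apply/asboolP => c f g; apply: laurent_ext => a b; rewrite LE /airy_dy !LE; ring.
Qed.

Let X := LaurentEnd airy_x_linear.
Let Y := LaurentEnd airy_y_linear.
Let U := LaurentEnd airy_dx_linear.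
Let W := LaurentEnd airy_dy_linear.

Lemma airy_relations : weyl_relations X Y U W.
Proof.
have E (f : V) a b a' b' : a = a' -> b = b' -> f a b = f a' b' by move=> -> ->.
have mE (p q : laurent_end K) f : (p * q) f = p (q f) by [].
have aE (p q : laurent_end K) f a b : (p + q) f a b = p f a b + q f a b by [].
have oE f : (1 : laurent_end K) f = f by [].
split; try split; apply: end_ext => f; apply: laurent_ext => a b;
  rewrite ?aE !mE ?oE /= /airy_dx /airy_dy /airy_x /airy_y //.
- rewrite (E f (a + 1 + 1) (b - 2) (a + 2) (b - 2)); try ring.
  rewrite (E f (a + 2) (b - 3 + 1) (a + 2) (b - 2)); try ring.
  rewrite (E f (a + 1 + 2) (b - 2 - 3) (a + 2 + 1) (b - 3 - 2)); try ring.
  rewrite (E f (a + 2) (b + 1 - 3) (a + 2) (b - 2)); try ring.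
  rewrite !intrD; field; by rewrite ?pnatr_eq0.
- rewrite !subrK addrK (_ : a - 1 + 2 = a + 2 - 1); last by ring.
  by rewrite !intrD; ring.
- rewrite !subrK addrK (_ : b - 2 - 1 = b - 1 - 2); last by ring.
  by rewrite !intrD; ring.
- by rewrite (_ : b - 3 - 1 = b - 1 - 3) //; ring.
- by rewrite subrK addrK.
Qed.

(** The weight is recorded in the type so that each value of it puts its own A-module structure on
    the same carrier. *)
Definition airy (_ : K) : Type := laurent K.
HB.instance Definition _ (w' : K) := GRing.Zmodule.on (airy w').

Definition airy_act (a : A) (f : airy w) : airy w := weyl_lift X Y U W a f.

Fact airy_actA a b f : airy_act a (airy_act b f) = airy_act (a * b) f.
Proof. by rewrite /airy_act (weyl_liftM airy_relations). Qed.

Fact airy_act1 : left_id 1 airy_act.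
Proof. by move=> f; rewrite /airy_act weyl_lift1. Qed.

Fact airy_actDr : right_distributive airy_act +%R.
Proof.
move=> a f g; rewrite /airy_act.
by have := end_linear (weyl_lift X Y U W a) 1 f g; rewrite !scale1r.
Qed.

Fact airy_actDl f : {morph airy_act^~ f : a b / a + b}.
Proof.
move=> a b; rewrite /airy_act.
by have := weyl_lift_linear X Y U W 1 a b; rewrite !scale1r => ->.
Qed.

HB.instance Definition _ := GRing.Zmodule_isLmodule.Build A (airy w)
  airy_actA airy_act1 airy_actDr airy_actDl.

Lemma airy_xE (f : airy w) : weyl_x K *: f = airy_x f.
Proof. by rewrite -[_ *: f]/(weyl_lift X Y U W _ f) weyl_lift_x. Qed.
Lemma airy_yE (f : airy w) : weyl_y K *: f = airy_y f.
Proof. by rewrite -[_ *: f]/(weyl_lift X Y U W _ f) weyl_lift_y. Qed.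
Lemma airy_dxE (f : airy w) : weyl_dx K *: f = airy_dx f.
Proof. by rewrite -[_ *: f]/(weyl_lift X Y U W _ f) weyl_lift_dx. Qed.
Lemma airy_dyE (f : airy w) : weyl_dy K *: f = airy_dy f.
Proof. by rewrite -[_ *: f]/(weyl_lift X Y U W _ f) weyl_lift_dy. Qed.

Lemma airy_scaleE (c : K) (f : airy w) a b : ((c%:A : A) *: f) a b = c * f a b.
Proof.
have L0 : weyl_lift X Y U W 0 = 0.
  by have := weyl_lift_linear X Y U W (-1) 0 0; rewrite !scaleN1r !addNr.
have LZ : weyl_lift X Y U W c%:A = c%:A.
  by rewrite -[c%:A in LHS]addr0 weyl_lift_linear weyl_lift1 L0 addr0.
by rewrite -[_ *: f]/(weyl_lift X Y U W (c%:A) f) LZ.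
Qed.

Lemma airy_addE (f g : airy w) a b : (f + g) a b = f a b + g a b.
Proof. by []. Qed.

Lemma airy_oppE (f : airy w) a b : (- f) a b = - f a b.
Proof. by []. Qed.

Lemma airy_natE n (f : airy w) a b : ((n%:R : A) *: f) a b = n%:R * f a b.
Proof. by rewrite -[n%:R]scaler_nat airy_scaleE. Qed.

(** The y^2 in E cancels against x times the logarithmic y-derivative of the exponential, leaving x
    d/dy on monomials. *)
Lemma airy_EE (f : airy w) a b : (kE K *: f) a b = (b + 1)%:~R * f (a - 1) (b + 1).
Proof.
rewrite scalerDl expr2 -!scalerA airy_addE airy_xE airy_dyE !airy_yE.
rewrite /airy_x /airy_dy /airy_y subrK (_ : b - 1 - 1 = b - 2) ?subrK //.
by ring.
Qed.

(** H is diagonal on monomials because y^3/x is homogeneous of degree 0 for 3x d/dx + y d/dy. *)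
Lemma airy_HE (f : airy w) a b :
  (kH K *: f) a b = ((3 * a + b)%:~R + w) * f a b.
Proof.
rewrite 2!scalerDl -!scalerA !airy_addE !airy_natE airy_xE airy_yE airy_dyE airy_dxE.
rewrite /airy_x /airy_dy /airy_y /airy_dx !subrK (_ : a - 1 + 2 = a + 1); last by ring.
rewrite (_ : b - 1 - 2 = b - 3); last by ring.
by field; rewrite ?pnatr_eq0.
Qed.

Lemma airy_FE (f : airy w) a b :
  (kF K *: f) a b = ((3 * a + 2 * b + 1)%:~R + w) * f (a + 1) (b - 1)
                    - ((b + 1) * (b + 2))%:~R * f a (b + 2).
Proof.
rewrite scalerBl expr2 -!scalerA airy_addE airy_oppE !airy_natE airy_yE.
rewrite airy_dxE !airy_dyE /airy_dy /airy_y /airy_dx.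
have E a1 b1 a2 b2 : a1 = a2 -> b1 = b2 -> f a1 b1 = f a2 b2 by move=> -> ->.
rewrite (E a (b + 1 + 1) a (b + 2)) ?(E (a + 1) (b + 1 - 2) (a + 1) (b - 1)); try ring.
rewrite (E (a + 2) (b - 1 - 3) (a + 1 + 1) (b - 2 - 2)); try ring.
rewrite (E (a + 1) (b - 2 + 1) (a + 1) (b - 1)); try ring.
by field; rewrite ?pnatr_eq0.
Qed.

End Airy.

(** * Highest weight vectors *)

Section LinearAlgebra.
Variables (K : fieldType) (V : lmodType K).

(** Applying T - lam n to the relation removes its last term and multiplies the others by nonzero
    scalars. *)
Lemma eigenvectors_independent (T : {linear V -> V}) (lam : nat -> K) n (w : nat -> V) :
  injective lam -> (forall i, T (w i) = lam i *: w i) ->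
  \sum_(i < n) w i = 0 -> forall i, (i < n)%N -> w i = 0.
Proof.
move=> lamI; elim: n w => [|n IH] w wE // w0.
have wn i : (i < n)%N -> w i = 0.
  move=> lin; have: (lam i - lam n) *: w i = 0.
    apply: (IH (fun j => (lam j - lam n) *: w j)) => // [j|].
      by rewrite linearZ /= wE !scalerA mulrC.
    have := congr1 (fun u => T u - lam n *: u) w0.
    rewrite linear0 scaler0 subr0 linear_sum scaler_sumr -sumrB big_ord_recr /=.
    rewrite wE subrr addr0 => H0; rewrite -[RHS]H0.
    by apply: eq_bigr => j _; rewrite wE scalerBl.
  move/eqP; rewrite scaler_eq0 subr_eq0 => /orP[/eqP/lamI eq_in|/eqP//].
  by rewrite eq_in ltnn in lin.
move=> i; rewrite ltnS leq_eqVlt => /orP[/eqP->|/wn//].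
by move: w0; rewrite big_ord_recr /= big1 ?add0r // => j _; exact: wn.
Qed.

Lemma has_dim_dependent (W : {pred V}) d n (w : 'I_n -> V) :
  has_dim W d -> (d < n)%N -> (forall i, w i \in W) ->
  exists2 c : 'I_n -> K, exists i, c i != 0 & \sum_i c i *: w i = 0.
Proof.
move=> [b [_ bW]] ltdn wW.
have /choice [c cE] i : exists c : 'I_d -> K, w i = \sum_j c j *: b j by apply/bW.
pose A := \matrix_(i, j) c i j.
(* The coordinate matrix has more rows than columns, so its left kernel is nonzero. *)
have /rowV0Pn [u /sub_kermxP uA u0] : kermx A != 0.
  rewrite kermx_eq0 /row_free; apply/eqP => rA.
  by have := rank_leq_col A; rewrite rA leqNgt ltdn.
exists (fun i => u 0 i); first by apply/rV0Pn.
transitivity (\sum_j (u *m A) 0 j *: b j); last first.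
  by rewrite big1 // => j _; rewrite uA mxE scale0r.
under eq_bigr do rewrite cE scaler_sumr.
rewrite exchange_big; apply: eq_bigr => j _ /=.
by rewrite mxE scaler_suml; apply: eq_bigr => i _; rewrite mxE scalerA.
Qed.

Lemma eigen_chain_vanishes (T : {linear V -> V}) (W : {pred V}) d
    (lam : nat -> K) (u : nat -> V) :
  has_dim W d -> injective lam -> (forall i, T (u i) = lam i *: u i) ->
  (forall i, u i \in W) -> exists i, u i = 0.
Proof.
move=> Wd lamI uE uW.
have [c [i ci] cu] := has_dim_dependent Wd (ltnSn d) (fun i : 'I_d.+1 => uW i).
pose c' j := oapp c 0 (insub j).
have c'E (j : 'I_d.+1) : c' j = c j by rewrite /c' valK.
have := @eigenvectors_independent T lam d.+1 (fun j => c' j *: u j) lamI.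
move=> /(_ _ _ i (ltn_ord i)) H; exists i; apply/eqP.
have : c' i *: u i = 0.
  apply: H => [j|]; first by rewrite linearZ /= uE !scalerA mulrC.
  by rewrite -[RHS]cu; apply: eq_bigr => j _; rewrite c'E.
by move/eqP; rewrite scaler_eq0 c'E (negbTE ci).
Qed.

End LinearAlgebra.

(** * Weight vectors and the Casimir element *)

Section Sl2.
Variables (K : numFieldType) (M : lmodType (weyl K)).
Local Notation A := (weyl K).
Local Notation V := (Defs.restrict M).
Local Notation E := (kE K).
Local Notation H := (kH K).
Local Notation F := (kF K).

(** Scaling by [a], typed on the restriction to K so that it can be declared a K-linear map. *)
Definition act (a : A) (v : V) : V := a *: (v : M).

Lemma actD a b v : act (a + b) v = act a v + act b v.
Proof. by rewrite /act scalerDl. Qed.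
Lemma actB a b v : act (a - b) v = act a v - act b v.
Proof. by rewrite /act scalerBl. Qed.
Lemma actM a b v : act (a * b) v = act a (act b v).
Proof. by rewrite /act scalerA. Qed.
Lemma act1 v : act 1 v = v.
Proof. by rewrite /act scale1r. Qed.
Lemma act0 v : act 0 v = 0.
Proof. by rewrite /act scale0r. Qed.
Lemma actS (c : K) a v : act (c *: a) v = c *: act a v.
Proof. by rewrite -[c *: act a v]/(act c%:A (act a v)) -actM -scalerAl mul1r. Qed.

Fact act_linear a : linear (act a).
Proof.
move=> c u v; rewrite /act scalerDr; congr (_ + _).
by rewrite -[c *: u]/(act c%:A u) -!/(act _ _) -actM -scalerAr mulr1 actS.
Qed.
HB.instance Definition _ a := GRing.isLinear.Build K V V *:%R (act a) (act_linear a).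

Lemma actZ a c v : act a (c *: v) = c *: act a v.
Proof. exact: linearZ. Qed.

Definition highest_weight (n : K) (v : V) : Prop := act E v = 0 /\ act H v = n *: v.

Lemma weight_E n v : act H v = n *: v -> act H (act E v) = (n + 2%:R) *: act E v.
Proof.
move=> Hv; rewrite -actM (_ : H * E = E * H + 2%:R *: E); last first.
  by rewrite -k_bracket_HE addrC subrK.
by rewrite actD actM Hv linearZ /= actS scalerDl.
Qed.

Lemma weight_F n v : act H v = n *: v -> act H (act F v) = (n - 2%:R) *: act F v.
Proof.
move=> Hv; rewrite -actM (_ : H * F = F * H - 2%:R *: F); last first.
  by rewrite -k_bracket_HF addrC subrK.
by rewrite actB actM Hv linearZ /= actS scalerBl.
Qed.

Lemma act_EF v : act E (act F v) = act F (act E v) + act H v.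
Proof. by rewrite -!actM -actD -k_bracket_EF addrC subrK. Qed.

Definition lower k v := iter k (act F) v.

Lemma lowerS k v : lower k.+1 v = act F (lower k v).
Proof. by []. Qed.

Section HighestWeight.
Variables (n : K) (v : V).
Hypothesis vn : highest_weight n v.

Lemma lower_H k : act H (lower k v) = (n - (2 * k)%:R) *: lower k v.
Proof.
elim: k => [|k IH]; first by rewrite muln0 subr0 /= vn.2.
by rewrite /= (weight_F IH) mulnS natrD; congr (_ *: _); ring.
Qed.

Lemma lower_E k : act E (lower k.+1 v) = (k.+1%:R * (n - k%:R)) *: lower k v.
Proof.
elim: k => [|k IH]; first by rewrite act_EF vn.1 vn.2 linear0 add0r mul1r subr0.
rewrite (lowerS k.+1) act_EF IH lower_H linearZ /= -?lowerS -scalerDl.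
by congr (_ *: _); rewrite mulnS natrD natrM; rewrite -[k.+2]addn1 -[k.+1]addn1 !natrD; ring.
Qed.

(** It acts on all F^k v by the same scalar n(n + 2), and thereby separates the components of
    different highest weights. *)
Definition casimir : A := 4%:R *: (F * E) + H * H + 2%:R *: H.

Lemma casimir_lower k : act casimir (lower k v) = (n * (n + 2%:R)) *: lower k v.
Proof.
have FE : act F (act E (lower k v)) = (k%:R * (n - k%:R + 1)) *: lower k v.
  case: k => [|k]; first by rewrite /= vn.1 linear0 mul0r scale0r.
  rewrite lower_E linearZ /=; congr (_ *: _).
  by rewrite -[k.+1]addn1 !natrD; ring.
rewrite !actD !actS !actM FE !lower_H actZ lower_H !scalerA -!scalerDl.
by congr (_ *: _); rewrite natrM; ring.
Qed.

(** If m + 1 is the first exponent with F^(m+1) v = 0, applying E gives (m + 1)(n - m) F^m v = 0, so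
    n = m. *)
Lemma highest_weight_nat k : v != 0 -> lower k v = 0 ->
  exists2 m : nat, n = m%:R & lower m.+1 v = 0.
Proof.
move=> v0 vk; have exk : exists k, lower k v == 0 by exists k; apply/eqP.
case: (ex_minnP exk) => -[|m] /eqP vm min; first by rewrite /= in vm; rewrite vm eqxx in v0.
exists m => //; have /eqP := lower_E m; rewrite vm linear0 eq_sym scaler_eq0.
rewrite mulf_eq0 pnatr_eq0 /= subr_eq0 => /orP[/eqP//|/min].
by rewrite ltnn.
Qed.

End HighestWeight.

Lemma kkE : E \in kk K.
Proof. by apply/asboolP; exists 1, 0, 0; rewrite scale1r !scale0r !addr0. Qed.
Lemma kkH : H \in kk K.
Proof. by apply/asboolP; exists 0, 1, 0; rewrite scale1r !scale0r add0r addr0. Qed.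
Lemma kkF : F \in kk K.
Proof. by apply/asboolP; exists 0, 0, 1; rewrite scale1r !scale0r !add0r. Qed.

Lemma lie_submodule_kk (W : {pred V}) : submod_closed W ->
  (forall w, w \in W -> act E w \in W) -> (forall w, w \in W -> act H w \in W) ->
  (forall w, w \in W -> act F w \in W) -> lie_submodule (kk K) W.
Proof.
move=> WS WE WH WF; split=> // _ w /asboolP[e [h [f ->]]] wW.
have [W0 WL] := WS; have WZ c u : u \in W -> c *: u \in W.
  by move=> uW; rewrite -[c *: u]addr0; exact: WL.
have WD u u' : u \in W -> u' \in W -> u + u' \in W.
  by rewrite -{2}[u]scale1r; exact: WL.
by rewrite -/(act _ _) !actD !actS; apply/WD; [apply/WD|]; apply/WZ; auto.
Qed.

End Sl2.

(** * Locally finite modules *)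

Section FiniteDimension.
Variables (K : fieldType) (V : lmodType K).

Lemma has_dim_ext (U W : {pred V}) d :
  (forall v, v \in U <-> v \in W) -> has_dim U d -> has_dim W d.
Proof. by move=> UW [b [bI bU]]; exists b; split=> // v; rewrite -UW. Qed.

Lemma has_dim_submod (U : {pred V}) d : has_dim U d -> submod_closed U.
Proof.
case=> b [_ bU]; split=> [|c u v /bU[x ->] /bU[y ->]]; apply/bU.
  by exists (fun=> 0); rewrite big1 // => i _; rewrite scale0r.
exists (fun i => c * x i + y i); rewrite scaler_sumr -big_split /=.
by apply: eq_bigr => i _; rewrite scalerDl scalerA.
Qed.

Lemma has_dim_add_vector (U : {pred V}) d (b : V) : has_dim U d ->
  exists e, has_dim (fun v => `[< exists c, v - c *: b \in U >]) e.
Proof.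
move=> Ud; have [U0 UL] := has_dim_submod Ud.
have [bU|bU] := boolP (b \in U).
  exists d; apply: has_dim_ext Ud => v; split=> [vU|/asboolP[c vU]].
    by apply/asboolP; exists 0; rewrite scale0r subr0.
  by rewrite -[v](subrK (c *: b)) addrC; exact: UL.
case: (Ud) => f [fI fU]; exists d.+1.
exists (fun i => oapp f b (unlift ord0 i)).
have S (c : 'I_d.+1 -> K) : \sum_i c i *: oapp f b (unlift ord0 i) =
    c ord0 *: b + \sum_i c (lift ord0 i) *: f i.
  by rewrite big_ord_recl unlift_none; congr (_ + _); apply: eq_bigr => i _; rewrite liftK.
split=> [c|v].
  rewrite S => c0; have c00 : c ord0 = 0.
    apply/eqP/negPn/negP => c00; case/negP: bU; apply/fU.
    exists (fun i => - (c ord0)^-1 * c (lift ord0 i)).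
    apply: (scalerI c00); move/eqP: c0; rewrite addr_eq0 => /eqP ->.
    rewrite -sumrN scaler_sumr; apply: eq_bigr => i _.
    by rewrite scalerA mulrA mulrN divff // mulN1r scaleNr.
  move: c0; rewrite c00 scale0r add0r => /fI cI i.
  by case: (unliftP ord0 i) => [j|] ->.
split=> [/asboolP[c /fU[x vE]]|[c ->]].
  exists (fun i => oapp x c (unlift ord0 i)); rewrite S unlift_none /=.
  by under eq_bigr do rewrite liftK /=; rewrite -vE addrC subrK.
by apply/asboolP; exists (c ord0); rewrite S addrC addKr; apply/fU; eexists.
Qed.

Definition add_pred (U W : {pred V}) : {pred V} :=
  fun v => `[< exists u w, [/\ u \in U, w \in W & v = u + w] >].

Lemma has_dim_add (U W : {pred V}) d e : has_dim U d -> has_dim W e ->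
  exists f, has_dim (add_pred U W) f.
Proof.
move=> Ud We; have [b [_ bW]] := We.
(* Extended by 0 to all of nat, so that the basis vectors can be added one at a time by
   induction. *)
pose b' i := oapp b 0 (insub i).
have b'E (i : 'I_e) : b' i = b i by rewrite /b' valK.
suff /(_ e) [f H] : forall k, exists f, has_dim (fun v => `[< exists u (c : nat -> K),
    u \in U /\ v = u + \sum_(i < k) c i *: b' i >]) f.
  exists f; apply: has_dim_ext H => v; split=> /asboolP[u].
    case=> c [uU ->]; apply/asboolP; exists u, (\sum_(i < e) c i *: b' i); split=> //.
    by apply/bW; exists (fun i => c i); apply: eq_bigr => i _; rewrite b'E.
  case=> w [uU /bW[c ->] ->]; apply/asboolP; exists u, (fun i => oapp c 0 (insub i)).
  by split=> //; congr (_ + _); apply: eq_bigr => i _; rewrite valK b'E.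
elim=> [|k [f IH]].
  exists d; apply: has_dim_ext Ud => v; split=> [vU|/asboolP[u [c [uU ->]]]].
    by apply/asboolP; exists v, (fun=> 0); rewrite big_ord0 addr0.
  by rewrite big_ord0 addr0.
have [g H] := has_dim_add_vector (b' k) IH.
exists g; apply: has_dim_ext H => v; split=> /asboolP.
  case=> x /asboolP[u [c [uU vE]]]; apply/asboolP.
  exists u, (fun i => if i == k then x else c i); split=> //.
  rewrite big_ord_recr /= eqxx addrA -[v](subrK (x *: b' k)) vE; congr (_ + _ + _).
  by apply: eq_bigr => i _; rewrite ltn_eqF.
case=> u [c [uU ->]]; apply/asboolP; exists (c k); apply/asboolP; exists u, c.
by split=> //; rewrite big_ord_recr addrA addrK.
Qed.

End FiniteDimension.

Section LocallyFinite.
Variables (K : numFieldType) (M : lmodType (weyl K)).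
Local Notation A := (weyl K).
Local Notation V := (Defs.restrict M).
Local Notation E := (kE K).
Local Notation H := (kH K).
Local Notation F := (kF K).

Definition finite_vector (m : V) : Prop := exists (W : {pred V}) (d : nat),
  [/\ lie_submodule (kk K) W, has_dim W d & m \in W].

Lemma finite_vectorD u v : finite_vector u -> finite_vector v -> finite_vector (u + v).
Proof.
move=> [U [d [[[U0 UL] Uk] Ud uU]]] [W [e [[[W0 WL] Wk] We vW]]].
have [f UWf] := has_dim_add Ud We; exists (add_pred U W), f; split=> //; last first.
  by apply/asboolP; exists u, v.
split; first exact: has_dim_submod UWf.
move=> a _ ak /asboolP[x [y [xU yW ->]]]; apply/asboolP; exists (act a x), (act a y).
by split; [exact: Uk | exact: Wk | exact: (linearD (act a))].
Qed.

Section SimpleHighestWeight.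
Variables (n : nat) (v : V).
Hypothesis vn : highest_weight n%:R v.
Hypothesis v0 : v != 0.

Lemma lower_neq0 k : (k <= n)%N -> lower k v != 0.
Proof.
elim: k => // k IH kn; apply/eqP => vk.
have /eqP := lower_E vn k; rewrite vk linear0 eq_sym scaler_eq0 (negbTE (IH (ltnW kn))).
rewrite orbF mulf_eq0 pnatr_eq0 subr_eq0 eqr_nat => /eqP nk.
by rewrite nk ltnn in kn.
Qed.

Lemma weights_injective : injective (fun k : nat => n%:R - (2 * k)%:R : K).
Proof.
by move=> i j /addrI /oppr_inj /eqP; rewrite eqr_nat eqn_mul2l => /eqP.
Qed.

Lemma lower_free k (c : nat -> K) : (k <= n.+1)%N ->
  \sum_(i < k) c i *: lower i v = 0 -> forall i, (i < k)%N -> c i = 0.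
Proof.
move=> kn c0 i ik; have := @eigenvectors_independent _ _ (act H)
  (fun k => n%:R - (2 * k)%:R) k (fun i => c i *: lower i v) weights_injective.
move=> /(_ _ c0 i ik) H0; apply/eqP; have /eqP : c i *: lower i v = 0.
  by apply: H0 => j; rewrite /= actZ (lower_H vn) !scalerA mulrC.
by rewrite scaler_eq0 (negbTE (lower_neq0 _)) ?orbF // -ltnS (leq_trans ik).
Qed.

Hypothesis vF : lower n.+1 v = 0.

Definition lower_span : {pred V} :=
  fun u => `[< exists c : nat -> K, u = \sum_(i < n.+1) c i *: lower i v >].

Lemma lower_span_closed : submod_closed lower_span.
Proof.
split=> [|a _ _ /asboolP[x ->] /asboolP[y ->]]; apply/asboolP.
  by exists (fun=> 0); rewrite big1 // => i _; rewrite scale0r.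
exists (fun i => a * x i + y i); rewrite scaler_sumr -big_split /=.
by apply: eq_bigr => i _; rewrite scalerDl scalerA.
Qed.

Lemma lower_in_span k : lower k v \in lower_span.
Proof.
have [kn|] := leqP k n.
  apply/asboolP; exists (fun i => (i == k)%:R).
  rewrite (bigD1 (Ordinal (kn : (k < n.+1)%N))) //= eqxx scale1r big1 ?addr0 //.
  by move=> i ik; rewrite (_ : (i : nat) == k = false) ?scale0r //; apply: negbTE.
move=> nk; rewrite (_ : lower k v = 0); first by have [] := lower_span_closed.
rewrite -(subnK nk) /lower iterD -/(lower _ v) vF.
by elim: (k - _)%N => //= j ->; rewrite linear0.
Qed.

Lemma span_closed_act (a : A) (W : {pred V}) : submod_closed W ->
  (forall k, act a (lower k v) \in W) -> forall u, u \in lower_span -> act a u \in W.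
Proof.
move=> [W0 WL] aW _ /asboolP[c ->]; rewrite linear_sum.
apply: (big_ind (fun x => x \in W)) => [//|x y xW yW|i _].
  by rewrite -[x]scale1r; exact: WL.
by rewrite /= actZ -[_ *: _]addr0; apply: WL.
Qed.

Lemma lower_span_lie : lie_submodule (kk K) lower_span.
Proof.
have [S0 SL] := lower_span_closed.
have SZ c k : c *: lower k v \in lower_span.
  by rewrite -[_ *: _]addr0; apply: SL => //; exact: lower_in_span.
apply: lie_submodule_kk; first exact: lower_span_closed.
- apply: span_closed_act; first exact: lower_span_closed.
  by case=> [|k]; [rewrite /= vn.1 | rewrite (lower_E vn)].
- apply: span_closed_act; first exact: lower_span_closed.
  by move=> k; rewrite (lower_H vn).
- apply: span_closed_act; first exact: lower_span_closed.
  by move=> k; rewrite -lowerS; exact: lower_in_span.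
Qed.

Lemma lower_span_dim : has_dim lower_span n.+1.
Proof.
exists (fun i => lower i v); split=> [c c0 i|u].
  pose c' j := oapp c 0 (insub j).
  have c'E (j : 'I_n.+1) : c' j = c j by rewrite /c' valK.
  rewrite -c'E; apply: (@lower_free n.+1) => //.
  by rewrite -[RHS]c0; apply: eq_bigr => j _; rewrite c'E.
split=> [/asboolP[c ->]|[c ->]]; first by exists (fun i => c i).
apply/asboolP; exists (fun j => oapp c 0 (insub j)).
by apply: eq_bigr => j _; rewrite valK.
Qed.

Lemma lower_span_casimir u : u \in lower_span ->
  act (casimir K) u = (n%:R * (n%:R + 2%:R)) *: u.
Proof.
move=> /asboolP[c ->]; rewrite linear_sum scaler_sumr; apply: eq_bigr => i _ /=.
by rewrite actZ (casimir_lower vn) !scalerA mulrC.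
Qed.

(** A submodule W without v is zero: E turns an element of W that combines the F^i v with i <= k + 1
    into one with i <= k, which vanishes by induction. As the factors (i + 1)(n - i) are nonzero,
    only a multiple of v is left, and it must be 0. *)
Lemma lower_span_V : is_V (kk K) n lower_span.
Proof.
split; last exact: lower_span_dim.
split; [exact: lower_span_lie | by exists v => //; exact: (lower_in_span 0)|].
move=> W [[W0 WL] Wk] WS.
have WZ c u : u \in W -> c *: u \in W.
  by move=> uW; rewrite -[c *: u]addr0; exact: WL.
have [vW|vW] := boolP (v \in W).
  right=> _ /asboolP[c ->].
  apply: (big_ind (fun x => x \in W)) => [//|x y xW yW|i _].
    by rewrite -[x]scale1r; exact: WL.
  apply: WZ; elim: (i : nat) => // j IH.
  by apply: (Wk F) => //; exact: kkF.
left=> u uW; have /asboolP[c uE] := WS u uW; move: uW; rewrite {}uE.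
suff: forall k (c : nat -> K), (k <= n)%N -> \sum_(i < k.+1) c i *: lower i v \in W ->
    \sum_(i < k.+1) c i *: lower i v = 0 by apply.
elim=> {c} [|k IH] c kn.
  rewrite big_ord1 => cv; have [->|c0] := eqVneq (c 0%N) 0; first by rewrite scale0r.
  by case/negP: vW; rewrite -[v](scalerK c0); exact: WZ.
set S := \sum_(i < _) _ => SW.
pose c' i := c i.+1 * (i.+1%:R * (n%:R - i%:R)).
have ES : act E S = \sum_(i < k.+1) c' i *: lower i v.
  rewrite linear_sum big_ord_recl /= actZ vn.1 scaler0 add0r.
  by apply: eq_bigr => i _; rewrite /= actZ (lower_E vn) scalerA.
have /lower_free c'0 : \sum_(i < k.+1) c' i *: lower i v = 0.
  by apply: IH; [exact: ltnW | rewrite -ES; apply: (Wk E) => //; exact: kkE].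
have SE : S = \sum_(i < 1) c i *: lower i v.
  rewrite /S big_ord_recl big_ord1 /= big1 ?addr0 // => i _.
  have /eqP := c'0 (leqW kn) i (ltn_ord i); rewrite /c' !mulf_eq0 pnatr_eq0 /=.
  rewrite subr_eq0 eqr_nat => /orP[/eqP-> //|/eqP ni]; first by rewrite scale0r.
  by move: (ltn_ord i); rewrite -ni ltnS leqNgt kn.
move: SW; rewrite SE big_ord1 => cv; have [->|c0] := eqVneq (c 0%N) 0.
  by rewrite scale0r.
by case/negP: vW; rewrite -[v](scalerK c0); exact: WZ.
Qed.

End SimpleHighestWeight.

(** The F^k v have the distinct weights n - 2k inside a finite-dimensional space, so one of them
    vanishes. *)
Lemma finite_highest_weight (n : K) (v : V) : finite_vector v -> v != 0 ->
  highest_weight n v -> exists2 m : nat, n = m%:R & lower m.+1 v = 0.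
Proof.
move=> [W [d [[_ Wk] Wd vW]]] v0 vn.
suff [k vk] : exists k, lower k v = 0 by exact: highest_weight_nat vk.
apply: (@eigen_chain_vanishes _ _ (act H) W d (fun k => n - (2 * k)%:R)) => //.
- by move=> i j /addrI /oppr_inj /eqP; rewrite eqr_nat eqn_mul2l => /eqP.
- exact: lower_H.
- by elim=> [|k IH] //; apply: (Wk F) => //; exact: kkF.
Qed.

End LocallyFinite.

(** * Existence of highest weight vectors *)

Section HighestWeightExists.
Variables (K : numClosedFieldType) (M : lmodType (weyl K)).
Local Notation A := (weyl K).
Local Notation V := (Defs.restrict M).
Local Notation E := (kE K).
Local Notation H := (kH K).
Local Notation F := (kF K).

(** Stability of [Q] is asked for E and H but not for F, so that [Q] may be the kernel of x. *)
Lemma finite_highest_weight_exists (Q : V -> Prop) (m : V) :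
  (forall c u v, Q u -> Q v -> Q (c *: u + v)) ->
  (forall u, Q u -> Q (act E u)) -> (forall u, Q u -> Q (act H u)) ->
  finite_vector m -> Q m -> m != 0 ->
  exists u n, [/\ Q u, u != 0 & highest_weight n u].
Proof.
move=> QL QE QH [W [d [[[W0 WL] Wk] Wd mW]]] Qm m0.
have QH' z u : Q u -> Q (act (H - z%:A) u).
  move=> Qu; rewrite actB actS act1 addrC -scaleNr; apply: QL => //; exact: QH.
have WH' z u : u \in W -> act (H - z%:A) u \in W.
  move=> uW; rewrite actB actS act1 addrC -scaleNr; apply: WL => //.
  by apply: (Wk H) => //; exact: kkH.
have [z [u [Qu uW u0 uz]]] : exists z u, [/\ Q u, u \in W, u != 0 & act H u = z *: u].
  have HkW k : act (H ^+ k) m \in W.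
    elim: k => [|k IH]; first by rewrite expr0 act1.
    by rewrite exprS actM; apply: (Wk H) => //; exact: kkH.
  (* A dependence among the vectors H^i m with i <= d is a nonzero polynomial p with p(H) m = 0. *)
  have [c [i ci] cm] := has_dim_dependent Wd (ltnSn d) (fun i : 'I_d.+1 => HkW i).
  pose p := \poly_(i < d.+1) oapp c 0 (insub i).
  have p0 : p != 0.
    apply/eqP => /(congr1 (fun q : {poly K} => q`_i)) /eqP.
    by rewrite coef_poly ltn_ord valK coef0 /= (negbTE ci).
  have pm : act (horner_alg H p) m = 0.
    rewrite /p poly_def linear_sum -[RHS]cm /=.
    rewrite (big_morph (fun a => act a m) (fun a b => actD a b m) (act0 m)).
    by apply: eq_bigr => j _; rewrite linearZ /= rmorphXn /= horner_algX -scalerAl mul1r actS valK.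
  have [rs pE] := closed_field_poly_normal p.
  have {pm} : act (horner_alg H (\prod_(z <- rs) ('X - z%:P))) m = 0.
    apply/eqP; move/eqP: pm; rewrite pE linearZ /= -scalerAl mul1r actS scaler_eq0 lead_coef_eq0.
    by rewrite (negbTE p0).
  have HzE z : horner_alg H ('X - z%:P) = H - z%:A.
    by rewrite rmorphB /= horner_algX horner_algC.
  have Q' rs' : Q (act (horner_alg H (\prod_(z <- rs') ('X - z%:P))) m) /\
                act (horner_alg H (\prod_(z <- rs') ('X - z%:P))) m \in W.
    elim: rs' => [|z rs' [IH IH']]; first by rewrite big_nil rmorph1 act1.
    by rewrite big_cons rmorphM /= actM HzE; split; [exact: QH' | exact: WH'].
  (* The linear factors of p are stripped off one by one; the first nonzero vector met this way is
     an eigenvector for the factor stripped last. *)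
  elim: rs {pE} => [|z rs IH]; first by rewrite big_nil rmorph1 act1 => /eqP; rewrite (negbTE m0).
  rewrite big_cons rmorphM /= actM HzE; have [Qu uW] := Q' rs.
  move: Qu uW IH; set u := act _ m => Qu uW IH uz.
  have [u00|u0] := eqVneq u 0; first exact: IH.
  exists z, u; split=> //; apply/eqP; rewrite -subr_eq0.
  by move: uz; rewrite actB actS act1 => ->.
(* E raises the weight by 2, so the E^k u eventually vanish and the last nonzero one is a highest
   weight vector. *)
pose e k := iter k (act E) u.
have ez k : act H (e k) = (z + (2 * k)%:R) *: e k.
  elim: k => [|k IH]; first by rewrite muln0 addr0.
  by rewrite /= (weight_E IH) mulnS natrD; congr (_ *: _); ring.
have eW k : e k \in W.
  by elim: k => [|k IH] //; apply: (Wk E) => //; exact: kkE.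
have Qe k : Q (e k) by elim: k => [|k IH] //; exact: QE.
have exk : exists k, e k == 0.
  have [] // := @eigen_chain_vanishes _ _ (act H) W d (fun k => z + (2 * k)%:R) e.
  - by move=> i j /addrI /eqP; rewrite eqr_nat eqn_mul2l => /eqP.
  - by move=> k /eqP ek; exists k.
case: (ex_minnP exk) => -[|k] /eqP ek min; first by rewrite -[u]/(e 0%N) ek eqxx in u0.
exists (e k), (z + (2 * k)%:R); split=> //.
by apply/negP => /min; rewrite ltnn.
Qed.

End HighestWeightExists.

(** * Annihilators of highest weight vectors *)

Section Annihilator.
Variable K : numFieldType.
Local Notation A := (weyl K).
Local Notation P := {mpoly K[2]}.
Local Notation mulp := (@weyl_mul_poly K).
Local Notation E := (kE K).
Local Notation H := (kH K).
Local Notation F := (kF K).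
Local Notation x := (weyl_x K).
Local Notation y := (weyl_y K).
Local Notation dx := (weyl_dx K).
Local Notation dy := (weyl_dy K).

Lemma mul_polyM p q : mulp (p * q) = mulp p * mulp q.
Proof. by apply: weyl_ext => r; rewrite weyl_mulE /= mulrA. Qed.

Lemma mul_polyD p q : mulp (p + q) = mulp p + mulp q.
Proof. by apply: weyl_ext => r; rewrite weyl_addE /= mulrDl. Qed.

Lemma mul_polyZ c p : mulp (c *: p) = c *: mulp p.
Proof. by apply: weyl_ext => r; rewrite weyl_scaleE /= scalerAl. Qed.

Lemma mul_polyXn k : mulp ('X_0 ^+ k) = x ^+ k.
Proof. by elim: k => [|k IH] //; rewrite !exprS mul_polyM IH. Qed.

(** This is x d/dy = E - y^2 with E moved to the right, where it kills a highest weight vector. *)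
Lemma x_dy_mul_poly p :
  x * dy * mulp p = mulp ('X_0 * p^`M(1) - 'X_1 ^+ 2 * p) + mulp p * E.
Proof.
apply: weyl_ext => q; rewrite weyl_addE !weyl_mulE kE_E /= mderivM; ring.
Qed.

(** Substituting x d/dy = E - y^2 into xH gives 3x^2 d/dx = x(H - n) - yE + (n - 2)x + y^3; the
    first two terms kill a highest weight vector of weight n. *)
Lemma x2_dx_mul_poly (n : K) p :
  3%:R *: (x * x * dx * mulp p) =
  mulp (3%:R *: ('X_0 * 'X_0 * p^`M(0)) + p * ((n - 2%:R) *: 'X_0 + 'X_1 ^+ 3))
  + mulp p * (x * (H - n%:A) - y * E).
Proof.
apply: weyl_ext => q; rewrite weyl_scaleE weyl_addE !weyl_mulE.
rewrite weyl_addE weyl_oppE !weyl_mulE weyl_addE weyl_oppE weyl_scaleE weyl_oneE kE_E kH_E.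
rewrite /= mderivM scalerBl scaler_nat -!mul_mpolyC mpolyC_nat; ring.
Qed.

Lemma E_mul_poly p : E * mulp p = mulp ('X_0 * p^`M(1)) + mulp p * E.
Proof.
by apply: weyl_ext => q; rewrite weyl_addE !weyl_mulE !kE_E /= mderivM; ring.
Qed.

Lemma H_mul_poly p :
  H * mulp p = mulp (3%:R *: ('X_0 * p^`M(0)) + 'X_1 * p^`M(1)) + mulp p * H.
Proof.
apply: weyl_ext => q; rewrite weyl_addE !weyl_mulE !kH_E /= !mderivM.
by rewrite -!mul_mpolyC mpolyC_nat; ring.
Qed.

Lemma dx_xn k : x ^+ k * dx = dx * x ^+ k - k%:R * x ^+ k.-1.
Proof.
have [_ _ [ux _] _ _] := weyl_gen_relations K.
by rewrite (comm_add1_exp _ ux) addrK.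
Qed.

(* Solving E v = 0 and H v = n v for the derivatives of v, up to powers of x. *)
Lemma highest_weight_reduce (n : K) (a : A) : exists k p,
  forall (M : lmodType A) (v : Defs.restrict M),
  highest_weight n v -> act (x ^+ k * a) v = act (mulp p) v.
Proof.
have [xy uv [ux vy] uy vx] := weyl_gen_relations K.
elim/weyl_ind: a => [|c a b [k [p kp]] [l [q lq]]|a [k [p kp]]|a [k [p kp]]|
                     a [k [p kp]]|a [k [p kp]]].
- by exists 0%N, 1 => M v _; rewrite expr0 mulr1.
- exists (k + l)%N, (c *: ('X_0 ^+ l * p) + 'X_0 ^+ k * q) => M v vn.
  rewrite mul_polyD mul_polyZ !mul_polyM !mul_polyXn mulrDr -scalerAr.
  rewrite {1}addnC !exprD -!mulrA !actD !actS !(actM _ (mulp _)) -kp // -lq //.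
  by rewrite -!actM.
- exists k, ('X_0 * p) => M v vn.
  by rewrite mulrA -exprSr exprS -mulrA mul_polyM !(actM x) kp.
- exists k, ('X_1 * p) => M v vn.
  by rewrite mulrA -(commrX k (esym xy : GRing.comm y x)) -mulrA mul_polyM !(actM y) kp.
(* The two extra powers of x allow the use of [x2_dx_mul_poly]; moving d/dx past x^k accounts for
   the summand with -k. *)
- exists k.+2, (3%:R^-1 *: (3%:R *: ('X_0 * 'X_0 * p^`M(0)) +
    p * ((n - 2%:R) *: 'X_0 + 'X_1 ^+ 3)) - k%:R *: ('X_0 * p)) => M v vn.
  have -> : x ^+ k.+2 * (dx * a) = x * x * dx * (x ^+ k * a) - k%:R *: (x * (x ^+ k * a)).
    rewrite !exprS -!mulrA (mulrA _ dx) dx_xn mulrBl !mulrBr -!mulrA; congr (_ - _).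
    rewrite scaler_nat mulr_natl !mulrnAr; case: k {kp} => [|k] //=.
    by rewrite exprS -!mulrA.
  have n3 : 3%:R != 0 :> K by rewrite pnatr_eq0.
  rewrite actB actS (actM (x * x * dx)) (actM x) kp // -!actM.
  rewrite -[x * x * dx * _](scalerK n3) (x2_dx_mul_poly n).
  move: (3%:R *: _ + p * _) => q; rewrite -!scaleNr mul_polyD !mul_polyZ mul_polyM !(actD, actS).
  congr (_ *: _ + _); rewrite -[RHS]addr0; congr (_ + _).
  by rewrite actM actB actM actD actS act1 scaleNr (actM y) vn.1 vn.2 subrr !linear0 addr0 linear0.
- exists k.+1, ('X_0 * p^`M(1) - 'X_1 ^+ 2 * p) => M v vn.
  have -> : x ^+ k.+1 * (dy * a) = x * dy * (x ^+ k * a).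
    by rewrite exprS -!mulrA (mulrA dy) (commrX k (vx : GRing.comm dy x)) -mulrA.
  rewrite (actM (x * dy)) kp // -!actM x_dy_mul_poly actD actM vn.1.
  by rewrite linear0 addr0.
Qed.

Definition x_injective (M : lmodType A) := forall u : Defs.restrict M, act x u = 0 -> u = 0.

(** The polynomials killing v are stable under both derivatives: commuting p with E and H produces x
    p_y and 3x p_x + y p_y, and x can be cancelled. A nonzero p would thus lead to a nonzero
    constant killing v. *)
Lemma highest_weight_torsion_free (M : lmodType A) (n : K) (v : Defs.restrict M) p :
  x_injective M -> highest_weight n v -> v != 0 -> act (mulp p) v = 0 -> p = 0.
Proof.
move=> xI vn v0 pv; apply/eqP/negPn/negP => p0.
have [|c c0] := @deriv_stable_const _ _ (fun p => act (mulp p) v = 0) p _ pv p0; last first.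
  rewrite -[c%:MP]mulr1 mul_mpolyC mul_polyZ actS -[mulp 1]/(1 : A) act1 => /eqP.
  by rewrite scaler_eq0 (negbTE c0) (negbTE v0).
have d1 q : act (mulp q) v = 0 -> act (mulp q^`M(1)) v = 0.
  move=> qv; apply: xI; rewrite -actM -mul_polyM.
  have := congr1 (fun a => act a v) (E_mul_poly q).
  by rewrite actD !(actM _ _ v) qv vn.1 !linear0 addr0 => <-.
have d0 q : act (mulp q) v = 0 -> act (mulp q^`M(0)) v = 0.
  move=> qv; have := congr1 (fun a => act a v) (H_mul_poly q).
  rewrite mul_polyD mul_polyZ !mul_polyM !actD actS !(actM _ _ v) qv d1 // vn.2.
  rewrite actZ qv !(linear0, scaler0, addr0) => /esym/eqP; rewrite scaler_eq0 pnatr_eq0 /=.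
  by move/eqP/xI.
by case=> -[|[|//]] i2 q; [have -> : Ordinal i2 = 0 by exact/val_inj
  | have -> : Ordinal i2 = 1 by exact/val_inj]; [exact: d0 | exact: d1].
Qed.

(** The same k and p reduce x^k a to p on v and on u. Hence a v = 0 forces p = 0, so x^k a u = 0,
    and x^k can be cancelled. *)
Lemma highest_weight_annihilator (M N : lmodType A) (n : K)
    (v : Defs.restrict M) (u : Defs.restrict N) a :
  x_injective M -> x_injective N -> highest_weight n v -> highest_weight n u ->
  v != 0 -> u != 0 -> act a v = 0 -> act a u = 0.
Proof.
move=> xM xN vn un v0 u0 av; have [k [p kp]] := highest_weight_reduce n a.
have p0 : p = 0.
  by apply: (highest_weight_torsion_free xM vn v0); rewrite -kp // actM av linear0.
have : act (x ^+ k * a) u = 0.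
  by rewrite kp // p0 -[0](scale0r 0) mul_polyZ actS scale0r.
elim: k {kp} => [|k IH]; first by rewrite mul1r.
by rewrite exprS -mulrA actM => /xN.
Qed.

End Annihilator.

Section XInjective.
Variables (K : numClosedFieldType) (M : lmodType (weyl K)).
Local Notation V := (Defs.restrict M).
Local Notation x := (weyl_x K).
Local Notation y := (weyl_y K).
Local Notation dx := (weyl_dx K).
Local Notation dy := (weyl_dy K).

(* A vector killed by x and y is a highest weight vector of weight -2. *)
Lemma locally_finite_x_injective : locally_finite (kk K) M -> x_injective M.
Proof.
have [xy uv [ux vy] uy vx] := weyl_gen_relations K.
move=> lf m xm; apply/eqP/negPn/negP => m0.
have [|||u [n [xu u0 [Eu _]]]] :=
  @finite_highest_weight_exists K M (fun u => act x u = 0) m _ _ _ (lf m) xm m0.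
- by move=> c u v xu xv; rewrite linearP /= xu xv scaler0 addr0.
- move=> u xu; rewrite -actM.
  have -> : x * kE K = kE K * x.
    by apply: weyl_ext => p; rewrite !weyl_mulE !kE_E /= mderivM mderiv_U /=; ring.
  by rewrite actM xu linear0.
- move=> u xu; rewrite -actM.
  have -> : x * kH K = kH K * x - 3%:R *: x.
    apply: weyl_ext => p; rewrite weyl_addE weyl_oppE weyl_scaleE !weyl_mulE !kH_E.
    by rewrite /= !mderivM !mderiv_U -!mul_mpolyC mpolyC_nat /=; ring.
  by rewrite actB actS actM xu !(linear0, addr0).
have actE (w : V) : act (kE K) w = act dy (act x w) + act y (act y w).
  by rewrite -!actM -actD vx.
have yyu : act y (act y u) = 0 by rewrite -Eu actE xu linear0 add0r.
have actH (w : V) : act (kH K) w =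
    3%:R *: act dx (act x w) + act dy (act y w) - 2%:R *: w.
  rewrite -!actM -actS -actD -[X in _ - _ *: X]act1 -actS -actB; congr act.
  apply: weyl_ext => p; rewrite kH_E.
  rewrite !(weyl_addE, weyl_oppE, weyl_scaleE, weyl_mulE) weyl_oneE.
  by rewrite /= !mderivM !mderiv_U -!mul_mpolyC mpolyC_nat /=; ring.
(* Since y^2 u = 0, either u or y u is killed by both x and y. *)
have [w [w0 xw yw]] : exists w : V, [/\ w != 0, act x w = 0 & act y w = 0].
  have [yu|yu] := eqVneq (act y u) 0; first by exists u.
  by exists (act y u); split=> //; rewrite -actM xy actM xu linear0.
have [|k] := @finite_highest_weight K M (- 2%:R) w (lf w) w0.
  split; first by rewrite actE xw yw !linear0 addr0.
  by rewrite actH xw yw !(linear0, addr0) add0r scaleNr.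
by move/eqP; rewrite -subr_eq0 -opprD oppr_eq0 -natrD pnatr_eq0.
Qed.

End XInjective.

(** * Cyclic modules *)

Section Cyclic.
Variables (A : nzRingType) (M : lmodType A) (v : M).

Definition generated : {pred M} := fun m => `[< exists a : A, m = a *: v >].

Lemma generated_closed : submod_closed generated.
Proof.
split=> [|c m n /asboolP[a ->] /asboolP[b ->]]; apply/asboolP.
  by exists 0; rewrite scale0r.
by exists (c * a + b); rewrite scalerDl scalerA.
Qed.

HB.instance Definition _ :=
  GRing.isSubmodClosed.Build A M generated generated_closed.

Record cyclic : Type :=
  Cyclic { cyclic_val :> M; cyclic_valP : cyclic_val \in generated }.

HB.instance Definition _ := [isSub for cyclic_val].
HB.instance Definition _ := [Choice of cyclic by <:].
HB.instance Definition _ := [SubChoice_isSubZmodule of cyclic by <:].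
HB.instance Definition _ := [SubZmodule_isSubLmodule of cyclic by <:].

Fact generator_subproof : v \in generated.
Proof. by apply/asboolP; exists 1; rewrite scale1r. Qed.

Definition generator : cyclic := Cyclic generator_subproof.

Lemma generatorP (m : cyclic) : exists a, m = a *: generator.
Proof. by have /asboolP[a ma] := cyclic_valP m; exists a; apply: val_inj. Qed.

End Cyclic.

(** Equality of the annihilators makes a v |-> a u well defined and injective; [f] and [g] choose a
    coefficient a for each element. *)
Lemma isomorphic_cyclic (K : fieldType) (A : algType K) (M N : lmodType A) (v : M) (u : N) :
  (forall m, exists a, m = a *: v) -> (forall m, exists a, m = a *: u) ->
  (forall a, a *: v = 0 <-> a *: u = 0) -> isomorphic M N.
Proof.
move=> /choice[f fE] /choice[g gE] vu.
have uE a b : a *: v = b *: v -> a *: u = b *: u.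
  by move=> /eqP; rewrite -subr_eq0 -scalerBl => /eqP/vu/eqP; rewrite scalerBl subr_eq0 => /eqP.
have vE a b : a *: u = b *: u -> a *: v = b *: v.
  by move=> /eqP; rewrite -subr_eq0 -scalerBl => /eqP/vu/eqP; rewrite scalerBl subr_eq0 => /eqP.
have phiL : linear (fun m => f m *: u).
  move=> a m n; rewrite scalerA -scalerDl; apply: uE.
  by rewrite -fE scalerDl -scalerA -!fE.
exists (HB.pack_for {linear M -> N} (fun m => f m *: u)
  (GRing.isLinear.Build A M N _ (fun m => f m *: u) phiL)).
exists (fun n => g n *: v) => [m|n] /=.
  by rewrite {2}(fE m); apply: vE; rewrite -gE.
by rewrite {2}(gE n); apply: uE; rewrite -fE.
Qed.

(** * Monomials in the function module *)

Section Delta.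
Variables (K : numFieldType) (w : K).
Local Notation A := (weyl K).
Local Notation V := (airy w).
Local Notation RV := (Defs.restrict V).

Definition delta (a b : int) : RV := fun i j => ((i == a) && (j == b))%:R.

Lemma airy_ext (f g : RV) : (forall a b, f a b = g a b) -> f = g.
Proof. exact: laurent_ext. Qed.

Lemma restrictZE (c : K) (f : RV) a b : (c *: f) a b = c * f a b.
Proof. exact: airy_scaleE. Qed.

Lemma restrictDE (f g : RV) a b : (f + g) a b = f a b + g a b.
Proof. by []. Qed.

Lemma restrictNE (f : RV) a b : (- f) a b = - f a b.
Proof. by []. Qed.

Lemma x_delta a b : act (weyl_x K) (delta a b) = delta (a + 1) b.
Proof. by rewrite /act airy_xE; apply: airy_ext => i j; rewrite /airy_x /delta subr_eq. Qed.

Lemma y_delta a b : act (weyl_y K) (delta a b) = delta a (b + 1).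
Proof. by rewrite /act airy_yE; apply: airy_ext => i j; rewrite /airy_y /delta subr_eq. Qed.

Lemma dy_delta a b :
  act (weyl_dy K) (delta a b) = b%:~R *: delta a (b - 1) - delta (a - 1) (b + 2).
Proof.
rewrite /act airy_dyE; apply: airy_ext => i j.
rewrite restrictDE restrictNE restrictZE /airy_dy /delta.
have -> : (j + 1 == b) = (j == b - 1) by rewrite (can2_eq (addrK _) (subrK _)).
have -> : (i + 1 == a) = (i == a - 1) by rewrite (can2_eq (addrK _) (subrK _)).
have -> : (j - 2 == b) = (j == b + 2) by rewrite subr_eq.
congr (_ - _).
have [->|ja] := eqVneq j (b - 1); first by rewrite subrK.
by rewrite andbF !mulr0.
Qed.

Lemma dx_delta a b : act (weyl_dx K) (delta a b) =
  (a%:~R + (w - 2%:R) / 3%:R) *: delta (a - 1) b + 3%:R^-1 *: delta (a - 2) (b + 3).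
Proof.
rewrite /act airy_dxE; apply: airy_ext => i j.
rewrite restrictDE !restrictZE /airy_dx /delta.
have -> : (i + 1 == a) = (i == a - 1) by rewrite (can2_eq (addrK _) (subrK _)).
have -> : (i + 2 == a) = (i == a - 2) by rewrite (can2_eq (addrK _) (subrK _)).
have -> : (j - 3 == b) = (j == b + 3) by rewrite subr_eq.
rewrite [X in _ + X = _]mulrC; congr (_ + _).
have [->|ja] := eqVneq i (a - 1); first by rewrite subrK.
by rewrite !mulr0.
Qed.

Lemma F_delta a b : act (kF K) (delta a b) =
  ((3 * a + 2 * b)%:~R + w) *: delta (a - 1) (b + 1) - (b * (b - 1))%:~R *: delta a (b - 2).
Proof.
rewrite /act; apply: airy_ext => i j.
rewrite airy_FE restrictDE restrictNE !restrictZE /delta.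
have -> : (i + 1 == a) = (i == a - 1) by rewrite (can2_eq (addrK _) (subrK _)).
have -> : (j + 2 == b) = (j == b - 2) by rewrite (can2_eq (addrK _) (subrK _)).
have -> : (j - 1 == b) = (j == b + 1) by rewrite subr_eq.
congr (_ - _).
  have [->|ja] := eqVneq i (a - 1); last by rewrite !mulr0.
  have [->|jb] := eqVneq j (b + 1); last by rewrite !mulr0.
  by congr (_ * _); congr (_%:~R + _); ring.
have [->|ja] := eqVneq j (b - 2); last by rewrite andbF !mulr0.
by congr (_ * _); congr (_%:~R); ring.
Qed.

Lemma delta_highest_weight a : highest_weight (3%:R * a%:~R + w) (delta a 0).
Proof.
split; rewrite /act; apply: airy_ext => i j.
  rewrite airy_EE /delta; have [j0|] := eqVneq (j + 1) 0; last by rewrite andbF mulr0.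
  by rewrite j0 mul0r.
rewrite airy_HE restrictZE /delta.
have [->|ia] := eqVneq i a; last by rewrite !mulr0.
have [->|ja] := eqVneq j 0; last by rewrite !mulr0.
by rewrite addr0 intrM.
Qed.

Lemma delta_neq0 a b : delta a b != 0.
Proof.
apply/eqP => /(congr1 (fun f : RV => f a b)) /eqP.
by rewrite /delta !eqxx oner_eq0.
Qed.

Lemma airy_x_injective : x_injective V.
Proof.
move=> f xf; apply: airy_ext => a b.
have := congr1 (fun f : RV => f (a + 1) b) xf.
by rewrite /act airy_xE /airy_x addrK.
Qed.

(** As E acts by x d/dy, the vector f involves no y; the powers x^a have distinct weights 3a + w, so
    even in an infinite formal sum only one of them can occur. *)
Lemma airy_highest_weight (f : RV) (n : K) : f != 0 -> highest_weight n f ->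
  exists a c, [/\ n = 3%:R * a%:~R + w, c != 0 & f = c *: delta a 0].
Proof.
move=> f0 [Ef Hf].
have fb a b : b != 0 -> f a b = 0.
  move=> b0; have /eqP := congr1 (fun f : RV => f (a + 1) (b - 1)) Ef.
  by rewrite /act airy_EE subrK addrK mulf_eq0 intr_eq0 (negbTE b0) => /eqP.
have [a fa] : exists a, f a 0 != 0.
  apply: contrapT => fa; case/negP: f0; apply/eqP; apply: airy_ext => a b.
  have [->|/fb //] := eqVneq b 0; apply/eqP/negPn/negP => fa0.
  by apply: fa; exists a.
have fH i : ((3 * i)%:~R + w) * f i 0 = n * f i 0.
  have := congr1 (fun f : RV => f i 0) Hf.
  by rewrite /act airy_HE restrictZE addr0.
have na := mulIf fa (fH a).
exists a, (f a 0); split=> //; first by rewrite -na intrM.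
apply: airy_ext => i j; rewrite restrictZE /delta.
have [->|j0] := eqVneq j 0; last by rewrite andbF mulr0 fb.
have [->|ia] := eqVneq i a; first by rewrite mulr1.
rewrite mulr0; apply/eqP/negPn/negP => fi.
have /eqP := mulIf fi (fH i); rewrite -na (inj_eq (addIr _)) eqr_int.
by move=> /eqP e; case/eqP: ia; lia.
Qed.

(* For v = delta a 0 of weight n, both dy F v and y F^2 v combine
   delta (a - 1) 0 and delta (a - 2) 3; the second term cancels here. *)
Definition lowering (n : K) : A :=
  (n - 1) *: (weyl_dy K * kF K) + weyl_y K * (kF K * kF K).

Lemma lowering_delta a (n := 3%:R * a%:~R + w) :
  act (lowering n) (delta a 0) = (n * (n - 1)) *: delta (a - 1) 0.
Proof.
rewrite actD actS !actM F_delta mul0r scale0r subr0 add0r !actZ F_delta dy_delta.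
have -> : (3 * a + 2 * 0)%:~R + w = n by rewrite mulr0 addr0 intrM.
have -> : (3 * (a - 1) + 2 * 1)%:~R + w = n - 1.
  by rewrite /n intrD !intrM intrB; ring.
rewrite subrr mulr0 scale0r subr0 actZ y_delta scale1r.
rewrite !(scalerBr, scalerA) (_ : 1 + 1 + 1 = 1 + 2 :> int) // (mulrC (n - 1)).
by rewrite subrK.
Qed.

(* These identities write A_1 delta_a in terms of F^i delta_(a+1), where A_1 is
   the span of the four generators; the coefficient of the remaining term
   vanishes for a = 0 because w is 0 or 1. *)
Lemma y_delta_F a (n := 3%:R * (a + 1)%:~R + w) :
  n *: act (weyl_y K) (delta a 0) = lower 1 (delta (a + 1) 0).
Proof.
rewrite lowerS /lower /= F_delta mul0r scale0r subr0 y_delta addrK; congr (_ *: _).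
by rewrite mulr0 addr0 intrM.
Qed.

Lemma F_delta1 a :
  act (kF K) (delta a 1) = (3%:R * a%:~R + 2%:R + w) *: delta (a - 1) 2.
Proof. by rewrite F_delta subrr mulr0 scale0r subr0 intrD intrM; congr (_ *: _). Qed.

Lemma dy_delta_F a (n := 3%:R * (a + 1)%:~R + w) :
  (n * (n - 1)) *: act (weyl_dy K) (delta a 0) = - lower 2 (delta (a + 1) 0).
Proof.
rewrite lowerS -y_delta_F actZ y_delta add0r F_delta1 dy_delta scale0r sub0r scalerN scalerA.
by congr (- (_ * _ *: _)); rewrite /n intrD; ring.
Qed.

Lemma dx_delta_F a (n := 3%:R * (a + 1)%:~R + w) :
  (n * (n - 1) * (3%:R * (n - 2%:R))) *: act (weyl_dx K) (delta a 0) =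
  lower 3 (delta (a + 1) 0) + (n * (n - 1) * ((n - 3%:R) * (n - 4%:R))) *: delta (a - 1) 0.
Proof.
have F2 : lower 2 (delta (a + 1) 0) = (n * (n - 1)) *: delta (a - 1) 2.
  rewrite -[LHS]opprK -dy_delta_F dy_delta scale0r sub0r scalerN opprK add0r.
  by congr (_ *: _).
rewrite lowerS F2 actZ F_delta -scalerA -[X in _ = _ + X]scalerA -scalerDr; congr (_ *: _).
rewrite dx_delta add0r scalerDr !scalerA (_ : a - 1 - 1 = a - 2); last by ring.
rewrite (_ : 2 + 1 = 3 :> int) // subrr addrC -[RHS]addrA -scaleNr -scalerDl.
have n3 : 3%:R != 0 :> K by rewrite pnatr_eq0.
congr (_ *: _ + _ *: _); last by rewrite !intrM /n !intrD; field.
by rewrite intrD !intrM intrB /n intrD; field.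
Qed.


End Delta.

(** * The two modules *)

Section Descent.
Variables (K : numFieldType) (M : lmodType (weyl K)).
Local Notation A := (weyl K).
Local Notation V := (Defs.restrict M).
Hypothesis xM : x_injective M.

Lemma generator_highest_weight (n : K) : highest_weight n (delta n 0 0).
Proof. by have := delta_highest_weight n 0; rewrite mulr0 add0r. Qed.

(** This transfers identities between the monomial 1 of the function module and a highest weight
    vector of any module on which x is injective. *)
Lemma delta_annihilator (n : K) (v : V) a : highest_weight n v -> v != 0 ->
  act a (delta n 0 0) = 0 <-> act a v = 0.
Proof.
move=> vn v0; have d0 := delta_neq0 n 0 0; have dn := generator_highest_weight n.
have xn := @airy_x_injective K n.
by split; [exact: (highest_weight_annihilator xn xM dn vn d0 v0) |
  exact: (highest_weight_annihilator xM xn vn dn v0 d0)].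
Qed.

Lemma highest_weight_descend (n : K) (v : V) : highest_weight n v -> v != 0 ->
  n != 0 -> n != 1 -> exists2 u : V, u != 0 & highest_weight (n - 3%:R) u.
Proof.
move=> vn v0 n0 n1; have ann a := delta_annihilator a vn v0.
have Ld : act (lowering n) (delta n 0 0) = (n * (n - 1)) *: delta n (-1) 0.
  by have := lowering_delta n 0; rewrite mulr0 !add0r.
have [Ed Hd] := delta_highest_weight n (-1).
exists (act (lowering n) v); last split.
- apply/eqP => Lv; case/negP: v0; apply/eqP.
  (* Multiplying by x undoes the shift of [lowering], so x * [lowering n] acts on v by n(n - 1),
     which is nonzero. *)
  have /ann : act (weyl_x K * lowering n - (n * (n - 1))%:A) (delta n 0 0) = 0.
    by rewrite actB actM Ld actZ x_delta actS act1 addNr subrr.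
  rewrite actB actM Lv linear0 sub0r actS act1 => /eqP; rewrite oppr_eq0 scaler_eq0.
  by rewrite mulf_eq0 subr_eq0 (negbTE n0) (negbTE n1) => /eqP.
- by rewrite -actM; apply/ann; rewrite actM Ld actZ Ed scaler0.
- have /ann : act (kH K * lowering n - (n - 3%:R) *: lowering n) (delta n 0 0) = 0.
    rewrite actB actS actM Ld actZ Hd !scalerA -scalerBl.
    by rewrite (_ : _ - _ = 0) ?scale0r // intrN; ring.
  by rewrite actB actS actM => /eqP; rewrite subr_eq0 => /eqP.
Qed.


End Descent.

Lemma highest_weight_01 (K : numFieldType) (M : lmodType (weyl K)) n
    (v : Defs.restrict M) : locally_finite (kk K) M -> x_injective M ->
  highest_weight n%:R v -> v != 0 ->
  exists w (u : Defs.restrict M), [/\ (w < 2)%N, u != 0 & highest_weight w%:R u].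
Proof.
move=> lf xM; elim/ltn_ind: n v => n IH v vn v0.
have [n2|n2] := ltnP n 2; first by exists n, v.
have [||u u0 un] := highest_weight_descend xM vn v0.
- by rewrite pnatr_eq0; case: n n2 {IH vn}.
- by rewrite -[1]/(1%:R) eqr_nat; case: n n2 {IH vn} => [|[]].
(* That n - 3 is again a natural number excludes n = 2. *)
have [m nm _] := finite_highest_weight (lf u) u0 un.
have nE : n = (m + 3)%N.
  by apply/eqP; rewrite -(eqr_nat K) natrD -nm subrK.
by apply: (IH m _ u) => //; [rewrite nE -addn1 leq_add2l | rewrite -nm].
Qed.

(** * Decomposition and simplicity *)

Section Structure.
Variables (K : numClosedFieldType) (w : nat).
Hypothesis w2 : (w < 2)%N.
Local Notation A := (weyl K).
Local Notation AV := (Defs.restrict (airy (w%:R : K))).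

(** The space of all formal sums is too large: x^a with a < 0 is a highest weight vector of negative
    weight there. Hence the passage to the submodule generated by the monomial 1. *)
Definition airy_module : lmodType A := cyclic (delta (w%:R : K) 0 0 : airy (w%:R : K)).
Local Notation C := airy_module.
Local Notation V := (Defs.restrict C).

Definition cval (m : V) : AV := cyclic_val (m : cyclic _).

Arguments cval : simpl never.

Lemma cval_inj : injective cval. Proof. exact: val_inj. Qed.
Lemma cvalD m n : cval (m + n) = cval m + cval n. Proof. by []. Qed.
Lemma cvalN m : cval (- m) = - cval m. Proof. by []. Qed.
Lemma cvalA a m : cval (act a m) = act a (cval m). Proof. by []. Qed.
Lemma cvalZ c m : cval (c *: m) = c *: cval m. Proof. by []. Qed.
Lemma cval_lower k m : cval (lower k m) = lower k (cval m).
Proof. by elim: k => // k IH; rewrite !lowerS cvalA IH. Qed.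

Definition top_vector (a : nat) : V := act (weyl_x K ^+ a) (generator _).

Lemma cval_top a : cval (top_vector a) = delta w%:R a 0.
Proof.
rewrite cvalA; elim: a => [|a IH]; first by rewrite expr0 act1.
by rewrite exprS actM IH x_delta -addn1.
Qed.

Lemma top_highest_weight a : highest_weight (3 * a + w)%:R (top_vector a).
Proof.
have [Ed Hd] := delta_highest_weight (w%:R : K) a.
split; apply: cval_inj; rewrite cvalA cval_top ?Ed // Hd cvalZ cval_top.
by rewrite natrD natrM.
Qed.

Lemma top_neq0 a : top_vector a != 0.
Proof.
by apply/eqP => /(congr1 cval); rewrite cval_top => /eqP; rewrite (negbTE (delta_neq0 _ _ _)).
Qed.

Lemma airy_module_highest_weight (m : V) n : m != 0 -> highest_weight n m ->
  exists (a : int) (c : K), [/\ n = (3 * a + w)%:~R, c != 0 & cval m = c *: delta w%:R a 0].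
Proof.
move=> m0 [Em Hm]; have [||a [c [nE c0 mE]]] := @airy_highest_weight K w%:R (cval m) n.
- by apply/eqP => m0'; case/eqP: m0; apply: cval_inj.
- by split; rewrite -cvalA ?Em // Hm.
by exists a, c; split=> //; rewrite nE intrD intrM.
Qed.

Lemma lower_top a : lower (3 * a + w).+1 (top_vector a) = 0.
Proof.
set n := (3 * a + w)%N; apply/eqP/negPn/negP => l0.
have tn := top_highest_weight a.
have [|b [_ [bE _ _]]] := @airy_module_highest_weight _ (n%:R - (2 * n.+1)%:R) l0.
  by split; [rewrite (lower_E tn) subrr mulr0 scale0r | rewrite (lower_H tn)].
have /eqP : (n%:Z - (2 * n.+1)%:Z)%:~R = (3 * b + w)%:~R :> K by rewrite -bE intrB.
(* With n = 3a + w, the weight -n - 2 is congruent to w modulo 3 only if w is congruent to 2. *)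
by rewrite eqr_int /n => /eqP; lia.
Qed.

Definition component (a : nat) : {pred V} := lower_span (3 * a + w) (top_vector a).

Lemma component_V a : is_V (kk K) (3 * a + w) (component a).
Proof. exact: lower_span_V (top_highest_weight a) (top_neq0 a) (lower_top a). Qed.

Definition component_sum : {pred V} := fun v => `[< exists n (u : nat -> V),
  (forall i, u i \in component i) /\ v = \sum_(i < n) u i >].

Let comp0 a : 0 \in component a.
Proof. by have [S0 SL] := lower_span_closed (3 * a + w) (top_vector a). Qed.

Lemma component_sum_closed : submod_closed component_sum.
Proof.
split=> [|c _ _ /asboolP[n [u [uc ->]]] /asboolP[m [v [vc ->]]]]; apply/asboolP.
  by exists 0%N, (fun=> 0); rewrite big_ord0.
(* Sums of different lengths are padded with zeros. *)
exists (maxn n m), (fun i => c *: (if (i < n)%N then u i else 0) + (if (i < m)%N then v i else 0)).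
split=> [i|].
  have [S0 SL] := lower_span_closed (3 * i + w) (top_vector i).
  by apply: SL; case: ifP => // _; exact: comp0.
rewrite big_split /= -scaler_sumr; congr (_ *: _ + _).
  by rewrite (big_ord_widen _ u (leq_maxl n m)) big_mkcond.
by rewrite (big_ord_widen _ v (leq_maxr n m)) big_mkcond.
Qed.

Lemma component_sub_sum a u : u \in component a -> u \in component_sum.
Proof.
move=> ua; apply/asboolP; exists a.+1, (fun i => if i == a then u else 0).
split=> [i|]; first by case: eqP => [->|].
by rewrite big_ord_recr /= eqxx big1 ?add0r // => i _; rewrite ltn_eqF.
Qed.

Let SL := (component_sum_closed).2.
Let SZ c u : u \in component_sum -> c *: u \in component_sum.
Proof. by move=> uS; rewrite -[c *: u]addr0; apply: SL => //; exact: (component_sum_closed).1. Qed.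
Let SD u v : u \in component_sum -> v \in component_sum -> u + v \in component_sum.
Proof. by rewrite -{2}[u]scale1r; exact: SL. Qed.

Lemma component_sum_act (a : A) :
  (forall b k, act a (lower k (top_vector b)) \in component_sum) ->
  forall u, u \in component_sum -> act a u \in component_sum.
Proof.
move=> aS _ /asboolP[n [u [uc ->]]]; rewrite linear_sum.
apply: (big_ind (fun x => x \in component_sum)) => [|x y|i _].
- exact: (component_sum_closed).1.
- exact: SD.
- by apply: (span_closed_act component_sum_closed (aS i)); exact: uc.
Qed.

Let lowerS_in k a : lower k (top_vector a) \in component_sum.
Proof. by apply: component_sub_sum; exact: (lower_in_span (lower_top a)). Qed.

Lemma gen_top_in_sum b : [/\ act (weyl_x K) (top_vector b) \in component_sum,
  act (weyl_y K) (top_vector b) \in component_sum,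
  act (weyl_dx K) (top_vector b) \in component_sum &
  act (weyl_dy K) (top_vector b) \in component_sum].
Proof.
have scal (c : K) u : c != 0 -> c *: u \in component_sum -> u \in component_sum.
  by move=> c0 cu; rewrite -[u](scalerK c0); exact: SZ.
have top1 : cval (top_vector b.+1) = delta w%:R (b%:Z + 1) 0 by rewrite cval_top -addn1.
pose n := 3%:R * (b%:Z + 1)%:~R + w%:R : K.
have nE : n = (3 * b.+1 + w)%:R.
  by rewrite /n natrD natrM (_ : b%:Z + 1 = b.+1) // -addn1 PoszD.
(* Here n is at least 3, so the factors n, n - 1, n - 2 in the identities for y, d/dx, d/dy can be
   divided out. *)
have n0 k : (k < 3)%N -> n - k%:R != 0.
  by move=> k3; rewrite nE subr_eq0 eqr_nat; apply/eqP; lia.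
have n00 : n != 0 by rewrite -[n]subr0; exact: (n0 0%N).
have n01 : n - 1 != 0 by exact: (n0 1%N).
split.
- by rewrite -actM -exprS; exact: (lowerS_in 0).
- apply: (scal n) => //.
  rewrite (_ : n *: _ = lower 1 (top_vector b.+1)) //; apply: cval_inj.
  by rewrite cval_lower cvalZ cvalA top1 cval_top y_delta_F.
- have n30 : n * (n - 1) * (3%:R * (n - 2%:R)) != 0.
    by rewrite !mulf_neq0 ?pnatr_eq0 //; exact: (n0 2%N).
  apply: (scal _ _ n30).
  case: b @n nE n0 n00 n01 n30 top1 => [|b] n nE n0 n00 n01 n30 top1.
    rewrite (_ : _ *: _ = lower 3 (top_vector 1)) //; apply: cval_inj.
    rewrite cval_lower cvalZ cvalA top1 cval_top dx_delta_F -/n.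
    (* For b = 0 the weight n is 3 or 4, which removes the term in x^(-1), to which no top vector
       corresponds. *)
    have -> : (n - 3%:R) * (n - 4%:R) = 0.
      rewrite nE; case: (w) w2 => [|[|//]] _.
        by rewrite (_ : (3 * 1 + 0)%N = 3%N) // subrr mul0r.
      by rewrite (_ : (3 * 1 + 1)%N = 4%N) // subrr mulr0.
    by rewrite mulr0 scale0r addr0.
  rewrite (_ : _ *: _ = lower 3 (top_vector b.+2) +
    (n * (n - 1) * ((n - 3%:R) * (n - 4%:R))) *: top_vector b).
    by apply: SD => //; apply: SZ; exact: (lowerS_in 0).
  apply: cval_inj; rewrite cvalD !cvalZ cval_lower cvalA top1 !cval_top dx_delta_F -/n.
  by rewrite (_ : b.+1%:Z - 1 = b) // -addn1 PoszD addrK.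
- apply: (scal (n * (n - 1))); first by rewrite mulf_neq0.
  rewrite (_ : _ *: _ = - lower 2 (top_vector b.+1)); first by rewrite -scaleN1r; exact: SZ.
  by apply: cval_inj; rewrite cvalN cvalZ cval_lower cvalA top1 cval_top dy_delta_F.
Qed.

(* Induction on k: [g, F] is again a multiple of a generator. *)
Lemma gen_in_sum b k : [/\ act (weyl_x K) (lower k (top_vector b)) \in component_sum,
  act (weyl_y K) (lower k (top_vector b)) \in component_sum,
  act (weyl_dx K) (lower k (top_vector b)) \in component_sum &
  act (weyl_dy K) (lower k (top_vector b)) \in component_sum].
Proof.
have FS u : u \in component_sum -> act (kF K) u \in component_sum.
  by apply: component_sum_act => c j; rewrite -lowerS.
elim: k => [|k [Sx Sy Su Sv]]; first exact: gen_top_in_sum.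
have comm (g g' : A) c u : g * kF K = kF K * g + c *: g' ->
    act g u \in component_sum -> act g' u \in component_sum ->
    act g (act (kF K) u) \in component_sum.
  by move=> gE gu g'u; rewrite -actM gE actD actM actS; apply: SD; [exact: FS | exact: SZ].
rewrite lowerS; split.
- apply: (comm _ _ (- 3%:R) _ _ Sx Sy); apply: weyl_ext => p.
  rewrite weyl_addE weyl_scaleE !weyl_mulE !kF_E /= !mderivM !mderiv_U /=.
  rewrite !mul0r !add0r -mul_mpolyC mpolyCN mpolyC_nat !mderivM !mderiv_U /=; ring.
- apply: (comm _ _ 2%:R _ _ Sy Sv); apply: weyl_ext => p.
  rewrite weyl_addE weyl_scaleE !weyl_mulE !kF_E /= !mderivM !mderiv_U /=.
  rewrite !mul0r !add0r !mul1r mderivD !mderivM !mderiv_U /= -mul_mpolyC mpolyC_nat; ring.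
- apply: (comm _ _ 0 _ _ Su Su); apply: weyl_ext => p.
  rewrite weyl_addE weyl_scaleE !weyl_mulE !kF_E /= mderivB !mderivM !mderiv_U /=.
  by rewrite scale0r mderiv_nat !(mderiv_comm 1 0); ring.
- apply: (comm _ _ 3%:R _ _ Sv Su); apply: weyl_ext => p.
  rewrite weyl_addE weyl_scaleE !weyl_mulE !kF_E /= mderivB !mderivM !mderiv_U /=.
  by rewrite mderiv_nat (mderiv_comm 1 0) -mul_mpolyC mpolyC_nat; ring.
Qed.

Lemma component_sum_full (m : V) : m \in component_sum.
Proof.
have [a ->] := generatorP (m : cyclic _); rewrite -/(act a (generator _)).
elim/weyl_ind: a => [|c a b IHa IHb|a IH|a IH|a IH|a IH].
- by have := lowerS_in 0 0; rewrite /lower /top_vector expr0.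
- by rewrite actD actS; exact: SL.
all: by rewrite actM; apply: component_sum_act IH => b k; case: (gen_in_sum b k).
Qed.

Lemma airy_module_locally_finite : locally_finite (kk K) C.
Proof.
move=> m; have /asboolP[n [u [uc ->]]] := component_sum_full m.
have fin i v : v \in component i -> finite_vector v.
  move=> vi; have [[lieW _ _] dimW] := component_V i.
  by exists (component i), (3 * i + w).+1.
apply: (big_ind (fun x : V => finite_vector x)) => [|x y|i _].
- by apply: (fin 0%N).
- exact: finite_vectorD.
- exact: fin (uc i).
Qed.

Lemma airy_module_decomposes : decomposes_as (kk K) (fun i => 3 * i + w)%N C.
Proof.
exists component; split; first exact: component_V.
split=> [v|n u uc u0].
  by have /asboolP := component_sum_full v.
(* Distinct Casimir eigenvalues make the sum of the components direct. *)
have lamI : injective (fun i => (3 * i + w)%:R * ((3 * i + w)%:R + 2%:R) : K).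
  move=> i j /eqP; rewrite -!natrD -!natrM eqr_nat => /eqP e; nia.
apply: (eigenvectors_independent (T := act (casimir K)) lamI) u0 => i.
exact: (lower_span_casimir (top_highest_weight i) (uc i)).
Qed.

(** A nonzero submodule contains a highest weight vector, hence some x^a, and [lowering] leads from
    there down to the generator. *)
Lemma airy_module_simple : simple_module C.
Proof.
split; first by exists (top_vector 0); exact: top_neq0.
move=> N [N0 NL]; have Na a m : m \in N -> a *: m \in N.
  by move=> mN; rewrite -[_ *: _]addr0; exact: NL.
have [[m0 m0N m00]|all0] := pselect (exists2 m, m \in N & m != 0); last first.
  by left=> m mN; apply/eqP/negPn/negP => m0; apply: all0; exists m.
right=> m.
have [|||u [n [uN u0 un]]] := @finite_highest_weight_exists K C (fun u => u \in N) m0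
  _ _ _ (airy_module_locally_finite m0) m0N m00.
- by move=> c u v uN vN; exact: NL.
- by move=> u; exact: Na.
- by move=> u; exact: Na.
have [k nk _] := finite_highest_weight (airy_module_locally_finite u) u0 un.
have [b [c [nE c0 uE]]] := airy_module_highest_weight u0 un.
have topN : exists a, top_vector a \in N.
  (* A negative exponent would give a negative weight, whereas highest weights are natural numbers
     here. *)
  case: b nE uE => [a|a] nE uE.
    exists a; rewrite -[top_vector a](scalerK c0); apply: (Na (c^-1)%:A).
    by rewrite (_ : c *: top_vector a = u) //; apply: cval_inj; rewrite cvalZ cval_top.
  have /eqP : (k%:Z)%:~R = (3 * Negz a + w)%:~R :> K by rewrite -nE nk.
  by rewrite eqr_int; lia.
have {topN} : top_vector 0 \in N.
  have [a] := topN; elim: a => // a IH aN; apply: IH.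
  pose n' := (3 * a.+1 + w)%:R : K.
  have n'0 : n' * (n' - 1) != 0.
    by rewrite mulf_neq0 ?subr_eq0 -1?[1]/(1%:R) /n' ?pnatr_eq0 ?eqr_nat //; apply/eqP; lia.
  rewrite -[top_vector a](scalerK n'0); apply: (Na (_^-1)%:A).
  rewrite (_ : _ *: top_vector a = act (lowering n') (top_vector a.+1)); first exact: Na.
  apply: cval_inj; rewrite cvalZ cvalA !cval_top.
  have := lowering_delta (w%:R : K) a.+1.
  rewrite (_ : 3%:R * _ + _ = n') => [->|]; last by rewrite /n' natrD natrM.
  by rewrite (_ : a.+1%:Z - 1 = a) // -addn1 PoszD addrK.
rewrite /top_vector expr0 act1 => gN; have [a ->] := generatorP (m : cyclic _).
exact: Na.
Qed.

End Structure.

(** The highest weights of the second module are congruent to 1 modulo 3, so none of them is 0. *)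
Lemma airy_module_not_isomorphic (K : numClosedFieldType) :
  ~ isomorphic (airy_module K 0) (airy_module K 1).
Proof.
case=> f fB; pose g : Defs.restrict (airy_module K 0) := top_vector K 0 0.
have fa a m : f (act a m) = act a (f m : Defs.restrict _) by rewrite /act linearZ.
have [Eg Hg] := top_highest_weight K 0 0.
have g0 : g != 0 by exact: top_neq0.
have [||a [c [nE _ _]]] := @airy_module_highest_weight K 1 (f g) 0.
- by apply/eqP => fg; case/eqP: g0; apply: (bij_inj fB); rewrite fg linear0.
- split; rewrite -fa; first by rewrite Eg linear0.
  by rewrite Hg muln0 addn0 !scale0r linear0.
have /eqP : 0%:~R = (3 * a + 1)%:~R :> K by rewrite -nE.
by rewrite eqr_int; lia.
Qed.

Lemma simple_module_classification (K : numClosedFieldType) (M : lmodType (weyl K)) :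
  simple_module_for (kk K) M ->
  isomorphic M (airy_module K 0) \/ isomorphic M (airy_module K 1).
Proof.
move=> [[[m m0] simM] lf]; have xM := locally_finite_x_injective lf.
have [//|//|//|u [n [_ u0 un]]] :=
  @finite_highest_weight_exists K M (fun=> True) m _ _ _ (lf m) I m0.
have [k nk _] := finite_highest_weight (lf u) u0 un; rewrite {}nk in un.
have [w [v [w2 v0 vw]]] := highest_weight_01 lf xM un u0.
suff : isomorphic M (airy_module K w) by case: w w2 {vw} => [|[|//]] _; [left | right].
apply: (@isomorphic_cyclic _ _ _ _ (v : M) (generator _)).
- move=> m1; have [|all0|full] := simM (generated (v : M)).
  + exact: generated_closed.
  + case/eqP: v0; apply: all0; exact: generator_subproof.
  + exact/asboolP/full.
- exact: generatorP.
(* Both annihilators equal that of [delta w%:R 0 0], the image of the generator under the injection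
   [cval]. *)
move=> a; have := delta_annihilator xM a vw v0; rewrite /act => <-.
by split=> [H|H]; [exact: (@cval_inj K w) | exact: (congr1 (@cval K w) H)].
Qed.

Theorem theorem10p7 (R : realType) :
  exists M0 M1 : lmodType (weyl R[i]),
    [/\ simple_module_for (kk R[i]) M0 /\ simple_module_for (kk R[i]) M1,
        decomposes_as (kk R[i]) (fun i => 3 * i)%N M0,
        decomposes_as (kk R[i]) (fun i => 3 * i + 1)%N M1,
        ~ isomorphic M0 M1 &
        forall M : lmodType (weyl R[i]), simple_module_for (kk R[i]) M ->
          isomorphic M M0 \/ isomorphic M M1].
Proof.
exists (airy_module R[i] 0), (airy_module R[i] 1); split.
- by split; split; [exact: airy_module_simple | exact: airy_module_locally_finite |
    exact: airy_module_simple | exact: airy_module_locally_finite].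
- have := @airy_module_decomposes R[i] 0 isT.
  by rewrite (_ : (fun i => 3 * i + 0)%N = (fun i => 3 * i)%N) //; apply/funext => i; rewrite addn0.
- exact: airy_module_decomposes.
- exact: airy_module_not_isomorphic.
- exact: simple_module_classification.
Qed.
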